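(* Consider the following bialgebra structures on $\langle\mathcal G\rangle_{\mathbb Q}$ (with unit $u$ and counit $\varepsilon$). (1) $(\cdot_{\mathrm{hom}},\Delta_{\mathrm{hom}'})$ and $(\cdot_{\mathrm{hom}'},\Delta_{\mathrm{hom}})$ are Hopf algebras, connected and graded by the number of vertices. (2) $(\cdot_{\mathrm{mono}},\Delta_{\mathrm{hom}'})$, $(\cdot_{\mathrm{mono}'},\Delta_{\mathrm{hom}})$, $(\cdot_{\mathrm{regmono}},\Delta_{\mathrm{hom}'})$, $(\cdot_{\mathrm{regmono}'},\Delta_{\mathrm{hom}})$ are connected filtered Hopf algebras, with filtration induced by the grading by number of vertices. (3) $(\cdot_{\mathrm{hom}'},\Delta_{\mathrm{mono}})$, $(\cdot_{\mathrm{hom}},\Delta_{\mathrm{mono}'})$, $(\cdot_{\mathrm{hom}'},\Delta_{\mathrm{regmono}})$ and $(\cdot_{\mathrm{hom}},\Delta_{\mathrm{regmono}'})$ fail to be Hopf algebras (they admit no antipode).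
   Context: Graphs are finite simple graphs (isolated vertices allowed, no loops, no parallel edges); $\mathsf e$ is the empty graph. A graph homomorphism $f:\sigma\to\tau$ is a map $V(\sigma)\to V(\tau)$ sending edges to edges. It is a monomorphism if injective on vertices; a regular monomorphism if it is an isomorphism onto the subgraph of $\tau$ induced by $f(V(\sigma))$. $\mathrm{Epi}(\sigma,\tau)$ is the set of homomorphisms surjective on vertices; $\mathrm{RegEpi}(\sigma,\tau)$ the set of those surjective on vertices and on edges. $\mathrm{Aut}(\sigma)$ is the automorphism group. $\mathcal G$ is the set of isomorphism classes of graphs, $\mathcal G_n$ those with $n$ vertices, and $\langle\mathcal G\rangle_{\mathbb Q}=\bigoplus_{n\ge0}\langle\mathcal G_n\rangle_{\mathbb Q}$ the $\mathbb Q$-vector space with basis $\mathcal G$, graded by number of vertices; the induced filtration is $\bigoplus_{i\le n}\langle\mathcal G_i\rangle_{\mathbb Q}$. A graded (resp. filtered) bialgebra is one whose product and coproduct respect the grading (resp. $A^nA^m\subset A^{n+m}$ and $\Delta(A^n)\subset\sum_{i+j=n}A^i\otimes A^j$); connected means the degree-zero part is $\mathbb Q\mathsf e$. $\langle\cdot,\cdot\rangle$ below is the bilinear pairing for which $\mathcal G$ (resp. $\mathcal G\times\mathcal G$ for tensors) is orthonormal. For $\sigma_1,\sigma_2,\tau\in\mathcal G$, with $\sqcup$ disjoint union, let $M(\sigma_1,\sigma_2;\tau)$ be the number of $f\in\mathrm{RegEpi}(\sigma_1\sqcup\sigma_2,\tau)$ such that $f|_{\sigma_1},f|_{\sigma_2}$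 are monomorphisms, and $R(\sigma_1,\sigma_2;\tau)$ the number of $f\in\mathrm{Epi}(\sigma_1\sqcup\sigma_2,\tau)$ such that $f|_{\sigma_1},f|_{\sigma_2}$ are regular monomorphisms. Linear operations on $\langle\mathcal G\rangle_{\mathbb Q}$: - $\cdot_{\mathrm{hom}}$: bilinear extension of disjoint union. - $\Delta_{\mathrm{hom}}(\tau)=\sum_{(\tau_1,\tau_2)\in\mathcal G^2}\langle\tau,\tau_1\cdot_{\mathrm{hom}}\tau_2\rangle\,\tau_1\otimes\tau_2$. - $\Delta_{\mathrm{hom}'}$: the unital algebra morphism for $\cdot_{\mathrm{hom}}$ with $\Delta_{\mathrm{hom}'}(\tau)=\tau\otimes\mathsf e+\mathsf e\otimes\tau$ for (nonempty) connected $\tau$. - $\Delta_{\mathrm{mono}}(\tau)=\sum_{(\sigma_1,\sigma_2)}\frac{M(\sigma_1,\sigma_2;\tau)}{|\mathrm{Aut}(\tau)|}\sigma_1\otimes\sigma_2$, $\quad\Delta_{\mathrm{mono}'}(\tau)=\sum_{(\sigma_1,\sigma_2)}\frac{M(\sigma_1,\sigma_2;\tau)}{|\mathrm{Aut}(\sigma_1)||\mathrm{Aut}(\sigma_2)|}\sigma_1\otimes\sigma_2$. - $\Delta_{\mathrm{regmono}}(\tau)=\sum_{(\sigma_1,\sigma_2)}\frac{R(\sigma_1,\sigma_2;\tau)}{|\mathrm{Aut}(\tau)|}\sigma_1\otimes\sigma_2$, $\quad\Delta_{\mathrm{regmono}'}(\tau)=\sum_{(\sigma_1,\sigma_2)}\frac{R(\sigma_1,\sigma_2;\tau)}{|\mathrm{Aut}(\sigma_1)||\mathrm{Aut}(\sigma_2)|}\sigma_1\otimes\sigma_2$.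 - For $x\in\{\mathrm{hom}',\mathrm{mono},\mathrm{mono}',\mathrm{regmono},\mathrm{regmono}'\}$: $\tau_1\cdot_x\tau_2=\sum_{\gamma\in\mathcal G}\langle\tau_1\otimes\tau_2,\Delta_x(\gamma)\rangle\,\gamma$ (a finite sum). - The unit is $u(1)=\mathsf e$; the counit is $\varepsilon(\mathsf e)=1$, $\varepsilon(\tau)=0$ for $\tau\ne\mathsf e$. A Hopf algebra is a bialgebra with an antipode, i.e. a linear map $S$ that is a two-sided convolution inverse of the identity. *)

(* Defs.v *)
From HB Require Import structures.
From mathcomp Require Import all_boot all_order all_algebra.
From mathcomp Require Import finmap boolp classical_sets fsbigop.
From mathcomp Require Import monalg.

Set Implicit Arguments.
Unset Strict Implicit.
Unset Printing Implicit Defensive.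

Import GRing.Theory.
Local Open Scope ring_scope.
Local Open Scope quotient_scope.

(* Finite simple graphs and their morphisms *)

Record simple_graph (V : finType) := SimpleGraph {
  adj :> rel V;
  adj_sym : symmetric adj;
  adj_irr : irreflexive adj
}.

Section Morphisms.
Variables (V W : finType) (e : simple_graph V) (f : simple_graph W).
Implicit Type h : V -> W.

Definition surj_vertices h := [forall w, exists v, h v == w].

Definition surj_edges h :=
  [forall w1, forall w2, f w1 w2 ==>
    [exists v1, exists v2, [&& e v1 v2, h v1 == w1 & h v2 == w2]]].

Definition is_hom h := [forall x, forall y, e x y ==> f (h x) (h y)].

Definition is_mono h := is_hom h && injectiveb h.

(* [h] is an isomorphism onto the subgraph of [f] induced by its image. *)
Definition is_regmono h :=
  injectiveb h && [forall x, forall y, e x y == f (h x) (h y)].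

Definition is_epi h := is_hom h && surj_vertices h.

Definition is_regepi h := [&& is_hom h, surj_vertices h & surj_edges h].

Definition is_iso h := is_regmono h && surj_vertices h.

Definition isomorphic := [exists h : {ffun V -> W}, is_iso h].

End Morphisms.

Definition aut_order (V : finType) (e : simple_graph V) : nat :=
  #|[pred h : {ffun V -> V} | is_iso e e h]|.

Definition connected_graph (V : finType) (e : simple_graph V) : bool :=
  (0 < #|V|)%N && [forall x, forall y, connect e x y].

Section DisjointUnion.
Variables (V W : finType) (e : simple_graph V) (f : simple_graph W).

Definition dunion_rel (a b : V + W) : bool :=
  match a, b with
  | inl x, inl y => e x y
  | inr x, inr y => f x y
  | _, _ => false
  end.

Fact dunion_sym : symmetric dunion_rel.
Proof. by move=> [x|x] [y|y] //=; rewrite adj_sym. Qed.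

Fact dunion_irr : irreflexive dunion_rel.
Proof. by move=> [x|x] /=; rewrite adj_irr. Qed.

Definition dunion : simple_graph (V + W)%type :=
  SimpleGraph dunion_sym dunion_irr.

End DisjointUnion.

Definition empty_graph : simple_graph void :=
  @SimpleGraph void (fun _ _ => false) (fun _ _ => erefl) (fun _ => erefl).

Section IsoTheory.

Lemma isoP (V W : finType) (e : simple_graph V) (f : simple_graph W) :
  reflect (exists2 h : V -> W, bijective h & forall x y, e x y = f (h x) (h y))
          (isomorphic e f).
Proof.
apply: (iffP existsP) => [[h /andP[/andP[/injectiveP hi /forallP he] /forallP hs]]|
  [h hb he]].
  exists h; last by move=> x y; apply/eqP; move/forallP: (he x); apply.
  apply: inj_card_bij => //.
  have hs' w : exists v, h v == w by apply/existsP/hs.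
  pose g w := xchoose (hs' w).
  apply: (@leq_card _ _ g); apply: (can_inj (g := h)) => w.
  exact/eqP/(xchooseP (hs' w)).
exists [ffun x => h x]; case: hb => g hK gK.
apply/andP; split; [apply/andP; split|].
- by apply/injectiveP => x y; rewrite !ffunE => /(can_inj hK).
- by apply/forallP => x; apply/forallP => y; rewrite !ffunE he.
- by apply/forallP => w; apply/existsP; exists (g w); rewrite ffunE gK.
Qed.

Lemma iso_refl (V : finType) (e : simple_graph V) : isomorphic e e.
Proof. by apply/isoP; exists id => //; exists id. Qed.

Lemma iso_sym (V W : finType) (e : simple_graph V) (f : simple_graph W) :
  isomorphic e f -> isomorphic f e.
Proof.
move=> /isoP[h [g hK gK] he]; apply/isoP; exists g; first by exists h.
by move=> x y; rewrite he !gK.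
Qed.

Lemma iso_trans (V W X : finType) (e : simple_graph V) (f : simple_graph W)
    (k : simple_graph X) :
  isomorphic e f -> isomorphic f k -> isomorphic e k.
Proof.
move=> /isoP[h hb he] /isoP[g gb ge]; apply/isoP; exists (g \o h).
  exact: bij_comp.
by move=> x y /=; rewrite he ge.
Qed.

Lemma iso_dunion (V W V' W' : finType) (e : simple_graph V) (f : simple_graph W)
    (e' : simple_graph V') (f' : simple_graph W') :
  isomorphic e e' -> isomorphic f f' -> isomorphic (dunion e f) (dunion e' f').
Proof.
move=> /isoP[h [h' hK h'K] he] /isoP[g [g' gK g'K] ge]; apply/isoP.
exists (fun a => match a with inl x => inl (h x) | inr y => inr (g y) end).
  exists (fun a => match a with inl x => inl (h' x) | inr y => inr (g' y) end);
  by move=> [x|x]; rewrite ?hK ?gK ?h'K ?g'K.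
by move=> [x|x] [y|y] //=.
Qed.

End IsoTheory.

(* Isomorphism classes: every finite graph is isomorphic to one whose vertex
   set is some ['I_n], which makes the set of isomorphism classes a quotient of
   a choiceType. *)

Definition pregraph := {n : nat & {set 'I_n * 'I_n}}.

Definition pregraph_rel (G : pregraph) : rel 'I_(tag G) :=
  fun x y => (x, y) \in tagged G.

Definition pregraph_simple (G : pregraph) : bool :=
  [forall x, forall y, pregraph_rel (G := G) x y == pregraph_rel y x]
  && [forall x, ~~ pregraph_rel (G := G) x x].

Record graph := Graph { graph_val :> pregraph; graphP : pregraph_simple graph_val }.

HB.instance Definition _ := [isSub for graph_val].
HB.instance Definition _ := [Choice of graph by <:].

Fact graph_rel_sym (G : graph) : symmetric (pregraph_rel (G := G)).
Proof.
by move=> x y; have /andP[/forallP/(_ x)/forallP/(_ y)/eqP] := graphP G.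
Qed.

Fact graph_rel_irr (G : graph) : irreflexive (pregraph_rel (G := G)).
Proof. by move=> x; have /andP[_ /forallP/(_ x)/negbTE] := graphP G. Qed.

Definition graph_rel (G : graph) : simple_graph 'I_(tag (graph_val G)) :=
  SimpleGraph (@graph_rel_sym G) (@graph_rel_irr G).

Section ToGraph.
Variables (V : finType) (e : simple_graph V).

Definition to_pregraph : pregraph :=
  Tagged (fun n => {set 'I_n * 'I_n})
    (finset (fun p : 'I_#|V| * 'I_#|V| => e (enum_val p.1) (enum_val p.2))).

Fact to_pregraph_simple : pregraph_simple to_pregraph.
Proof.
apply/andP; split; apply/forallP => x; first apply/forallP => y.
  by rewrite /pregraph_rel /= !inE /= adj_sym.
by rewrite /pregraph_rel /= !inE /= adj_irr.
Qed.

Definition to_graph : graph := Graph to_pregraph_simple.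

Lemma to_graph_iso : isomorphic (graph_rel to_graph) e.
Proof.
apply/isoP; exists (fun i => enum_val i); first exact: enum_val_bij.
by move=> x y; rewrite /= /pregraph_rel inE.
Qed.

End ToGraph.

Definition graph_iso : rel graph :=
  fun G H => isomorphic (graph_rel G) (graph_rel H).

Fact graph_iso_refl : reflexive graph_iso.
Proof. by move=> G; apply: iso_refl. Qed.
Fact graph_iso_sym : symmetric graph_iso.
Proof. by move=> G H; apply/idP/idP => /iso_sym. Qed.
Fact graph_iso_trans : transitive graph_iso.
Proof. by move=> G H K; apply: iso_trans. Qed.

Canonical graph_iso_equiv := EquivRel graph_iso
  graph_iso_refl graph_iso_sym graph_iso_trans.

Definition isoclass := {eq_quot graph_iso_equiv}.
HB.instance Definition _ := Quotient.on isoclass.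
(* The classical structure, rather than that of the quotient, which
   unification would try to evaluate. *)
HB.instance Definition _ := gen_eqMixin isoclass.
HB.instance Definition _ := gen_choiceMixin isoclass.

Definition iclass (V : finType) (e : simple_graph V) : isoclass :=
  \pi_isoclass (to_graph e).

Definition nverts (s : isoclass) : nat := tag (graph_val (repr s)).

Definition rep (s : isoclass) : simple_graph 'I_(nverts s) := graph_rel (repr s).

Lemma iclassP (V W : finType) (e : simple_graph V) (f : simple_graph W) :
  reflect (iclass e = iclass f) (isomorphic e f).
Proof.
apply: (iffP idP) => [ef|/eqmodP].
  apply/eqmodP; apply: iso_trans (to_graph_iso e) _.
  exact: iso_trans ef (iso_sym (to_graph_iso f)).
move=> efg; apply: iso_trans (iso_sym (to_graph_iso e)) _.
exact: iso_trans efg (to_graph_iso f).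
Qed.

Lemma rep_iclass (s : isoclass) : iclass (rep s) = s.
Proof.
rewrite -[RHS]reprK; apply/eqmodP; exact: to_graph_iso.
Qed.

Lemma iclass_rep (V : finType) (e : simple_graph V) : isomorphic (rep (iclass e)) e.
Proof. by apply/iclassP; rewrite rep_iclass. Qed.

Definition eG : isoclass := iclass empty_graph.

Definition union (s t : isoclass) : isoclass := iclass (dunion (rep s) (rep t)).

Definition connected_class (s : isoclass) : bool := connected_graph (rep s).

Definition Aut_card (s : isoclass) : nat := aut_order (rep s).

Definition Mcount (s1 s2 t : isoclass) : nat :=
  #|[pred f : {ffun 'I_(nverts s1) + 'I_(nverts s2) -> 'I_(nverts t)} |
      [&& is_regepi (dunion (rep s1) (rep s2)) (rep t) f,
          is_mono (rep s1) (rep t) (fun x => f (inl x))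
        & is_mono (rep s2) (rep t) (fun x => f (inr x))]]|.

Definition Rcount (s1 s2 t : isoclass) : nat :=
  #|[pred f : {ffun 'I_(nverts s1) + 'I_(nverts s2) -> 'I_(nverts t)} |
      [&& is_epi (dunion (rep s1) (rep s2)) (rep t) f,
          is_regmono (rep s1) (rep t) (fun x => f (inl x))
        & is_regmono (rep s2) (rep t) (fun x => f (inr x))]]|.

(* Linear algebra over a vector space with a distinguished basis.  The tensor
   product of the spaces with bases [K] and [L] is realised as the space with
   basis [K * L]. *)

Notation free K := {malg rat[K]}.

Section LinExt.
Variables (K : choiceType) (W : lmodType rat) (f : K -> W).

Definition lin_ext (x : free K) : W := \sum_(k <- msupp x) x@_k *: f k.

Lemma lin_extEw (x : free K) (d : {fset K}) : (msupp x `<=` d)%fset ->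
  lin_ext x = \sum_(k <- d) x@_k *: f k.
Proof.
move=> le; rewrite /lin_ext (big_fset_incl _ le) // => k _ kx.
by rewrite mcoeff_outdom // scale0r.
Qed.

Fact lin_ext_linear : linear lin_ext.
Proof.
move=> a x y.
pose d := (msupp x `|` msupp y)%fset.
have lx : (msupp x `<=` d)%fset by apply: fsubsetUl.
have ly : (msupp y `<=` d)%fset by apply: fsubsetUr.
have lxy : (msupp (a *: x + y) `<=` d)%fset.
  apply: fsubset_trans (msuppD_le _ _) _.
  exact/fsetSU/msuppZ_le.
rewrite (lin_extEw lx) (lin_extEw ly) (lin_extEw lxy) scaler_sumr -big_split.
by apply: eq_bigr => k _ /=; rewrite mcoeffD mcoeffZ scalerDl scalerA.
Qed.

HB.instance Definition _ :=
  GRing.isLinear.Build rat (free K) W *:%R lin_ext lin_ext_linear.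

Lemma lin_extU (k : K) : lin_ext << k >> = f k.
Proof. by rewrite /lin_ext msuppU oner_eq0 big_seq_fset1 mcoeffUU scale1r. Qed.

End LinExt.

Definition bilin_ext (K L : choiceType) (W : lmodType rat) (f : K -> L -> W)
    (x : free K) (y : free L) : W :=
  lin_ext (fun k => lin_ext (f k) y) x.

(* The pairing for which the basis is orthonormal. *)
Definition pairing (K : choiceType) (x y : free K) : rat :=
  \sum_(k <- msupp x) x@_k * y@_k.

Definition tens (K L : choiceType) (x : free K) (y : free L) : free (K * L)%type :=
  bilin_ext (fun k l => << (k, l) >>) x y.

Definition tens_map (K K' L L' : choiceType)
    (f : free K -> free K') (g : free L -> free L') :
    free (K * L)%type -> free (K' * L')%type :=
  lin_ext (fun p => tens (f << p.1 >>) (g << p.2 >>)).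

Definition tens_assoc (K : choiceType) :
    free (K * K * K)%type -> free (K * (K * K))%type :=
  lin_ext (fun p => << (p.1.1, (p.1.2, p.2)) >>).

(* The product of the tensor square of the algebra with product [mul]. *)
Definition tens_mul (K : choiceType) (mul : free K -> free K -> free K) :
    free (K * K)%type -> free (K * K)%type -> free (K * K)%type :=
  bilin_ext (fun p q => tens (mul << p.1 >> << q.1 >>) (mul << p.2 >> << q.2 >>)).

Section Bialgebras.
Variables (K : choiceType) (mul : free K -> free K -> free K).
Variables (u : rat -> free K) (Delta : free K -> free (K * K)%type).
Variable (eps : free K -> rat).

Record bialgebra : Prop := {
  mul_linearl : forall y, linear (mul^~ y);
  mul_linearr : forall x, linear (mul x);
  unit_linear : linear (u : rat^o -> free K);
  coproduct_linear : linear Delta;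
  counit_linear : scalar eps;
  product_assoc : associative mul;
  unit_left : left_id (u 1) mul;
  unit_right : right_id (u 1) mul;
  coproduct_coassoc : forall x,
    tens_assoc (tens_map Delta id (Delta x)) = tens_map id Delta (Delta x);
  counit_left : forall x,
    lin_ext (fun p => eps << p.1 >> *: << p.2 >>) (Delta x) = x;
  counit_right : forall x,
    lin_ext (fun p => eps << p.2 >> *: << p.1 >>) (Delta x) = x;
  coproduct_mul : forall x y, Delta (mul x y) = tens_mul mul (Delta x) (Delta y);
  coproduct_unit : Delta (u 1) = tens (u 1) (u 1);
  counit_mul : forall x y, eps (mul x y) = eps x * eps y;
  counit_unit : eps (u 1) = 1
}.

Definition convolution (f g : free K -> free K) (x : free K) : free K :=
  lin_ext (fun p => mul (f << p.1 >>) (g << p.2 >>)) (Delta x).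

Definition antipode (S : free K -> free K) : Prop :=
  [/\ linear S, forall x, convolution S id x = u (eps x)
    & forall x, convolution id S x = u (eps x)].

Definition hopf_algebra : Prop := bialgebra /\ exists S, antipode S.

(* [subtens A B] is the subspace [A (x) B] of the tensor square. *)
Definition subtens (A B : free K -> Prop) (z : free (K * K)%type) : Prop :=
  exists2 s : seq (free K * free K),
    (forall p, p \in s -> A p.1 /\ B p.2) &
    z = \sum_(p <- s) tens p.1 p.2.

(* The subspace [\sum_(i + j = n) A i (x) A j]. *)
Definition total_tens (A : nat -> free K -> Prop) (n : nat)
    (z : free (K * K)%type) : Prop :=
  exists2 w : 'I_n.+1 -> free (K * K)%type,
    (forall i : 'I_n.+1, subtens (A i) (A (n - i)%N) (w i)) & z = \sum_i w i.

(* Compatibility of the two operations with a family of subspaces: used both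
   for a grading and for a filtration. *)
Definition respects (A : nat -> free K -> Prop) : Prop :=
  (forall n m x y, A n x -> A m y -> A (n + m)%N (mul x y)) /\
  (forall n x, A n x -> total_tens A n (Delta x)).

Definition connected (A : nat -> free K -> Prop) : Prop :=
  forall x, A 0%N x <-> exists c, x = u c.

End Bialgebras.

(* The sums over all isomorphism classes below have finite support, as
   [\sum_(i \in A) F i] requires to be meaningful: all the coproducts involved
   bound the number of vertices of each factor of a term by that of the graph,
   and the latter by the sum of the former. *)

Local Notation QG := (free isoclass).
Local Notation QG2 := (free (isoclass * isoclass)%type).

Definition vgrading (n : nat) (x : QG) : Prop :=
  forall s, s \in msupp x -> nverts s = n.

Definition vfiltration (n : nat) (x : QG) : Prop :=
  forall s, s \in msupp x -> (nverts s <= n)%N.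

Definition unit_map (c : rat) : QG := c *: << eG >>.

Definition counit (x : QG) : rat := x@_eG.

Definition mul_hom : QG -> QG -> QG := bilin_ext (fun s t => << union s t >>).

Definition Delta_hom : QG -> QG2 :=
  lin_ext (fun t => \sum_(p \in [set: isoclass * isoclass])
    pairing << t >> (mul_hom << p.1 >> << p.2 >>) *: << p >>).

Definition Delta_mono : QG -> QG2 :=
  lin_ext (fun t => \sum_(p \in [set: isoclass * isoclass])
    ((Mcount p.1 p.2 t)%:R / (Aut_card t)%:R : rat) *: << p >>).

Definition Delta_mono' : QG -> QG2 :=
  lin_ext (fun t => \sum_(p \in [set: isoclass * isoclass])
    ((Mcount p.1 p.2 t)%:R / ((Aut_card p.1)%:R * (Aut_card p.2)%:R) : rat) *: << p >>).

Definition Delta_regmono : QG -> QG2 :=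
  lin_ext (fun t => \sum_(p \in [set: isoclass * isoclass])
    ((Rcount p.1 p.2 t)%:R / (Aut_card t)%:R : rat) *: << p >>).

Definition Delta_regmono' : QG -> QG2 :=
  lin_ext (fun t => \sum_(p \in [set: isoclass * isoclass])
    ((Rcount p.1 p.2 t)%:R / ((Aut_card p.1)%:R * (Aut_card p.2)%:R) : rat) *: << p >>).

(* The unital algebra morphisms for [mul_hom] with the prescribed values on
   connected graphs: there is exactly one, by [primitive_morphism_exists] and
   [primitive_morphism_unique]. *)
Definition primitive_morphism (D : QG -> QG2) : Prop :=
  [/\ linear D, D << eG >> = tens << eG >> << eG >>,
      forall x y, D (mul_hom x y) = tens_mul mul_hom (D x) (D y)
    & forall t, connected_class t ->
        D << t >> = tens << t >> << eG >> + tens << eG >> << t >>].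

Lemma basis_ext (K : choiceType) (W : lmodType rat) (f g : {linear free K -> W}) :
  (forall k, f << k >> = g << k >>) -> f =1 g.
Proof.
move=> fg x; rewrite [x]monalgE !raddf_sum; apply: eq_bigr => k _.
have -> : << x@_k *g k >> = x@_k *: << k >> :> free K.
  by apply/malgP => l; rewrite mcoeffZ !mcoeffU; case: eqP; rewrite ?mulr1 ?mulr0.
by apply: etrans (linearZZ f _ _) _; apply: etrans (esym (linearZZ g _ _)); rewrite fg.
Qed.

Section Bilin.
Variables (K L : choiceType) (W : lmodType rat) (f : K -> L -> W).

Lemma bilin_extU k l : bilin_ext f << k >> << l >> = f k l.
Proof. by rewrite /bilin_ext !lin_extU. Qed.

Lemma bilin_ext_linearl y : linear ((bilin_ext f)^~ y).
Proof. by move=> a x x'; rewrite /bilin_ext linearP. Qed.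

Lemma bilin_ext_linearr x : linear (bilin_ext f x).
Proof.
move=> a y y'; rewrite /bilin_ext /lin_ext scaler_sumr -big_split.
apply: eq_bigr => k _ /=; rewrite -![\sum_(l <- _) _]/(lin_ext (f k) _).
by rewrite linearP scalerDr !scalerA mulrC.
Qed.

HB.instance Definition _ x :=
  GRing.isLinear.Build rat (free L) W *:%R (bilin_ext f x) (bilin_ext_linearr x).

Lemma bilin_ext_suml (I : Type) (r : seq I) (P : pred I) (F : I -> free K) y :
  bilin_ext f (\sum_(i <- r | P i) F i) y = \sum_(i <- r | P i) bilin_ext f (F i) y.
Proof. exact: (raddf_sum (lin_ext (fun k => lin_ext (f k) y))). Qed.

Lemma bilin_ext_sumr (I : Type) (r : seq I) (P : pred I) (F : I -> free L) x :
  bilin_ext f x (\sum_(i <- r | P i) F i) = \sum_(i <- r | P i) bilin_ext f x (F i).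
Proof. exact: raddf_sum. Qed.

End Bilin.

Lemma bilin_basis_ext (K L : choiceType) (W : lmodType rat)
    (f g : free K -> free L -> W) :
  (forall y, linear (f^~ y)) -> (forall x, linear (f x)) ->
  (forall y, linear (g^~ y)) -> (forall x, linear (g x)) ->
  (forall k l, f << k >> << l >> = g << k >> << l >>) ->
  forall x y, f x y = g x y.
Proof.
move=> fl fr gl gr fg x y.
pose F1 : {linear free K -> W} := HB.pack (f^~ y)
  (GRing.isLinear.Build _ _ _ _ _ (fl y)).
pose G1 : {linear free K -> W} := HB.pack (g^~ y)
  (GRing.isLinear.Build _ _ _ _ _ (gl y)).
apply: (@basis_ext _ _ F1 G1) => k /=.
pose F2 : {linear free L -> W} := HB.pack (f << k >>)
  (GRing.isLinear.Build _ _ _ _ _ (fr << k >>)).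
pose G2 : {linear free L -> W} := HB.pack (g << k >>)
  (GRing.isLinear.Build _ _ _ _ _ (gr << k >>)).
by apply: (@basis_ext _ _ F2 G2) => l /=.
Qed.

Section Induced.
Variables (V : finType) (e : simple_graph V) (A : {set V}).

Definition induced : simple_graph {x : V | x \in A} :=
  @SimpleGraph _ (fun x y => e (val x) (val y))
    (fun x y => adj_sym e _ _) (fun x => adj_irr e _).

(* [A] is a union of connected components. *)
Definition closed_set : bool :=
  [forall x, forall y, e x y ==> ((x \in A) == (y \in A))].

Lemma closed_setP :
  reflect (forall x y, e x y -> (x \in A) = (y \in A)) closed_set.
Proof.
apply: (iffP forallP) => [h x y exy|h x].
  by have /forallP/(_ y)/implyP/(_ exy)/eqP := h x.
by apply/forallP => y; apply/implyP => /h ->.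
Qed.

End Induced.

Lemma iso_induced (V W : finType) (e : simple_graph V) (f : simple_graph W)
    (h : V -> W) (g : W -> V) (A : {set V}) (B : {set W}) :
  cancel h g -> cancel g h -> (forall x y, e x y = f (h x) (h y)) ->
  (forall x, (x \in A) = (h x \in B)) -> isomorphic (induced e A) (induced f B).
Proof.
move=> hK gK he hAB; apply/isoP.
have pA (x : {x | x \in A}) : h (val x) \in B by rewrite -hAB (valP x).
have pB (y : {y | y \in B}) : g (val y) \in A by rewrite hAB gK (valP y).
exists (fun x => exist (fun y => y \in B) (h (val x)) (pA x)).
  exists (fun y => exist (fun x => x \in A) (g (val y)) (pB y)) => x;
  by apply/val_inj; rewrite /= ?hK ?gK.
by move=> x y /=.
Qed.

Lemma induced_split (V : finType) (e : simple_graph V) (A : {set V}) :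
  closed_set e A -> isomorphic (dunion (induced e A) (induced e (~: A))) e.
Proof.
move=> /closed_setP cA; apply/isoP.
exists (fun a => match a with inl x => val x | inr y => val y end).
  apply: inj_card_bij => [[[x xA]|[x xA]] [[y yA]|[y yA]] /= xy|].
  - by congr inl; apply/val_inj.
  - suff: x \in ~: A by rewrite inE xA.
    by rewrite xy.
  - suff: y \in ~: A by rewrite inE yA.
    by rewrite -xy.
  - by congr inr; apply/val_inj.
  by rewrite card_sum !card_sig cardsC.
move=> [[x xA]|[x xA]] [[y yA]|[y yA]] //=; apply/esym/negbTE/negP => /cA.
  by move: (yA); rewrite inE xA => /negbTE ->.
by move: (xA); rewrite inE yA => /negbTE ->.
Qed.

Lemma induced_dunion (V W : finType) (e : simple_graph V) (f : simple_graph W)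
    (A : {set V + W}) (A1 : {set V}) (A2 : {set W}) :
  (forall x, (inl x \in A) = (x \in A1)) -> (forall x, (inr x \in A) = (x \in A2)) ->
  isomorphic (induced (dunion e f) A) (dunion (induced e A1) (induced f A2)).
Proof.
move=> h1 h2; apply: iso_sym; apply/isoP.
have p1 (x : {x | x \in A1}) : inl (val x) \in A by rewrite h1 (valP x).
have p2 (x : {x | x \in A2}) : inr (val x) \in A by rewrite h2 (valP x).
pose h (a : {x | x \in A1} + {x | x \in A2}) : {x | x \in A} := match a with
  | inl x => exist (fun y => y \in A) (inl (val x)) (p1 x)
  | inr x => exist (fun y => y \in A) (inr (val x)) (p2 x) end.
exists h; last by move=> [x|x] [y|y].
have hi : injective h.
  move=> [x|x] [y|y] /(congr1 val) //= [] /val_inj -> //.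
have hs : forall b, exists a, h a = b.
  move=> [[x|x] px].
    have px' : x \in A1 by rewrite -h1.
    by exists (inl (exist (fun y => y \in A1) x px')); apply/val_inj.
  have px' : x \in A2 by rewrite -h2.
  by exists (inr (exist (fun y => y \in A2) x px')); apply/val_inj.
apply: inj_card_bij => //.
have hs' b : exists a, h a == b by have [a <-] := hs b; exists a.
pose g b := xchoose (hs' b).
apply: (@leq_card _ _ g); apply: (can_inj (g := h)) => w.
exact/eqP/(xchooseP (hs' w)).
Qed.

(* An explicit form of the morphism, through the decompositions of a graph into
   two complementary unions of components. *)
Definition closed_sum (V : finType) (e : simple_graph V) : QG2 :=
  \sum_(A : {set V} | closed_set e A)
    << (iclass (induced e A), iclass (induced e (~: A))) >>.

Lemma closed_sum_iso (V W : finType) (e : simple_graph V) (f : simple_graph W) :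
  isomorphic e f -> closed_sum e = closed_sum f.
Proof.
move=> /isoP[h [g hK gK] he]; rewrite /closed_sum.
rewrite (reindex (fun A : {set W} => finset (fun x : V => h x \in A))) /=; last first.
  exists (fun A : {set V} => finset (fun x : W => g x \in A)) => A _;
  by apply/setP => x; rewrite !inE ?hK ?gK.
apply: eq_big => [A|A _].
  apply/closed_setP/closed_setP => cA x y.
    by move=> fxy; have := cA (g x) (g y); rewrite he !inE !gK; apply.
  by rewrite he !inE => /cA.
have -> : iclass (induced e (finset (fun x : V => h x \in A))) = iclass (induced f A).
  by apply/iclassP/(iso_induced hK gK he) => x; rewrite inE.
have -> // : iclass (induced e (~: finset (fun x : V => h x \in A)))
    = iclass (induced f (~: A)).
by apply/iclassP/(iso_induced hK gK he) => x; rewrite !inE.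
Qed.

Lemma union_iclass (V W : finType) (e : simple_graph V) (f : simple_graph W) :
  union (iclass e) (iclass f) = iclass (dunion e f).
Proof. by apply/iclassP/iso_dunion; apply: iclass_rep. Qed.

Lemma mul_homU s t : mul_hom << s >> << t >> = << union s t >>.
Proof. exact: bilin_extU. Qed.

Lemma tensU (K L : choiceType) (k : K) (l : L) : tens << k >> << l >> = << (k, l) >>.
Proof. exact: bilin_extU. Qed.

Lemma tens_mul_homU s s' t t' :
  tens_mul mul_hom << (s, s') >> << (t, t') >> = << (union s t, union s' t') >>.
Proof.
rewrite /tens_mul bilin_extU -tensU -!mul_homU; reflexivity.
Qed.

Lemma closed_sum_dunion (V W : finType) (e : simple_graph V) (f : simple_graph W) :
  closed_sum (dunion e f) = tens_mul mul_hom (closed_sum e) (closed_sum f).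
Proof.
rewrite {1}/tens_mul /closed_sum bilin_ext_suml.
under [RHS]eq_bigr do rewrite bilin_ext_sumr.
rewrite pair_big_dep /=.
pose j (p : {set V} * {set W}) : {set V + W} :=
  finset (fun a => match a with inl x => x \in p.1 | inr y => y \in p.2 end).
rewrite (reindex j) /=; last first.
  exists (fun A : {set V + W} => (finset (fun x => inl x \in A), finset (fun y => inr y \in A))).
    by move=> [A B] _; congr pair; apply/setP => x; rewrite !inE.
  by move=> A _; apply/setP => -[x|x]; rewrite !inE.
apply: eq_big => [[A B]|[A B] _] /=.
  apply/closed_setP/andP => [cA|[/closed_setP cA /closed_setP cB]].
    split; apply/closed_setP => x y.
      by move=> exy; have := cA (inl x) (inl y); rewrite !inE /=; apply.
    by move=> exy; have := cA (inr x) (inr y); rewrite !inE /=; apply.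
  by move=> [x|x] [y|y] //=; rewrite !inE /=; [move/cA|move/cB].
rewrite -[RHS]/(tens_mul mul_hom _ _) tens_mul_homU !union_iclass.
congr << _ >>; congr pair; apply/iclassP/induced_dunion => x; by rewrite !inE.
Qed.

Lemma void_iso (V : finType) (e : simple_graph V) : #|V| = 0%N -> iclass e = eG.
Proof.
move=> V0; apply/iclassP/iso_sym/isoP.
exists (fun x : void => match x with end); last by case.
apply: inj_card_bij; first by case.
by rewrite V0.
Qed.

Lemma induced0 (V : finType) (e : simple_graph V) : iclass (induced e finset.set0) = eG.
Proof. by apply: void_iso; rewrite card_sig; apply: cards0. Qed.

Lemma inducedT (V : finType) (e : simple_graph V) :
  iclass (induced e [set: V]%SET) = iclass e.
Proof.
apply/iclassP/isoP; exists val => //.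
apply: inj_card_bij; first exact: val_inj.
by rewrite card_sig; apply/eq_leq/esym; rewrite -cardsT; apply: eq_card => x; rewrite !inE.
Qed.

Lemma connected_closed (V : finType) (e : simple_graph V) (A : {set V}) :
  connected_graph e -> closed_set e A ->
  (A == finset.set0) || (A == [set: V]%SET).
Proof.
move=> /andP[_ /forallP ce] /closed_setP cA.
case: (set_0Vmem A) => [->|[x xA]]; first by rewrite eqxx.
apply/orP; right; apply/eqP/setP => y; rewrite inE.
have /forallP/(_ y)/connectP[p pp ->] := ce x.
elim: p x xA pp => //= z p IHp x xA /andP[exz pp].
by apply: IHp pp => //; rewrite -(cA x z).
Qed.

Lemma closed_sum_connected (V : finType) (e : simple_graph V) :
  connected_graph e ->
  closed_sum e = tens << iclass e >> << eG >> + tens << eG >> << iclass e >>.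
Proof.
move=> ce; have V0 : (0 < #|V|)%N by case/andP: ce.
have c0 : closed_set e finset.set0 by apply/closed_setP => x y; rewrite !inE.
have cT : closed_set e [set: V]%SET by apply/closed_setP => x y; rewrite !inE.
have T0 : [set: V]%SET != finset.set0 by rewrite -card_gt0 cardsT.
rewrite /closed_sum (bigD1 [set: V]%SET) //= (bigD1 finset.set0) /=; last first.
  by rewrite c0 eq_sym T0.
rewrite [X in _ + (_ + X)]big1 => [|A /andP[/andP[cA AT] A0]]; last first.
  by have := connected_closed ce cA; rewrite (negbTE AT) (negbTE A0).
by rewrite addr0 finset.setCT finset.setC0 inducedT induced0 !tensU.
Qed.

Lemma tens_mul_linearl mul y : linear ((@tens_mul isoclass mul)^~ y).
Proof. exact: bilin_ext_linearl. Qed.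
Lemma tens_mul_linearr mul x : linear (@tens_mul isoclass mul x).
Proof. exact: bilin_ext_linearr. Qed.

Lemma linear_comp (U V W : lmodType rat) (f : U -> V) (g : V -> W) :
  linear f -> linear g -> linear (fun x => g (f x)).
Proof. by move=> lf lg a x y; rewrite lf lg. Qed.

Lemma primitive_morphism_exists : exists D, primitive_morphism D.
Proof.
exists (lin_ext (fun t => closed_sum (rep t))).
have lD : linear (lin_ext (fun t => closed_sum (rep t))) by apply: lin_ext_linear.
split=> //.
- rewrite lin_extU tensU (closed_sum_iso (iclass_rep empty_graph)) /closed_sum.
  rewrite (bigD1 finset.set0) /=; last by apply/closed_setP => -[].
  rewrite big1 ?addr0 => [|A /andP[_ /negP[]]]; last by apply/eqP/setP => -[].
  congr << _ >>; congr pair; apply: void_iso; rewrite card_sig;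
  by apply: eq_card0 => -[].
- apply: bilin_basis_ext.
  + by move=> y; apply: linear_comp => //; apply: bilin_ext_linearl.
  + by move=> x; apply: linear_comp => //; apply: bilin_ext_linearr.
  + by move=> y; apply: linear_comp => //; apply: tens_mul_linearl.
  + by move=> x; apply: linear_comp => //; apply: tens_mul_linearr.
  move=> s t; rewrite mul_homU !lin_extU -closed_sum_dunion.
  exact/closed_sum_iso/iclass_rep.
by move=> t ct; rewrite lin_extU (closed_sum_connected ct) rep_iclass.
Qed.

Lemma nverts_iclass (V : finType) (e : simple_graph V) : nverts (iclass e) = #|V|.
Proof.
have /isoP[h /bij_eq_card + _] := iclass_rep e.
by rewrite card_ord.
Qed.

Lemma primitive_morphism_unique D D' :
  primitive_morphism D -> primitive_morphism D' -> D = D'.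
Proof.
move=> [l1 e1 m1 c1] [l2 e2 m2 c2]; apply/funext.
pose F : {linear QG -> QG2} := HB.pack D (GRing.isLinear.Build _ _ _ _ _ l1).
pose G : {linear QG -> QG2} := HB.pack D' (GRing.isLinear.Build _ _ _ _ _ l2).
apply: (@basis_ext _ _ F G) => t /=.
have [n] := ubnP (nverts t); elim: n t => // n IHn t; rewrite ltnS => tn.
have [t0|t_gt0] := posnP (nverts t).
  have -> : t = eG by rewrite -(rep_iclass t); apply: void_iso; rewrite card_ord.
  by rewrite e1 e2.
have [ct|] := boolP (connected_class t); first by rewrite c1 // c2.
rewrite /connected_class /connected_graph card_ord t_gt0 /= => /forallPn[x /forallPn[y xy]].
pose A : {set 'I_(nverts t)} := finset (fun z => connect (rep t) x z).
have cA : closed_set (rep t) A.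
  apply/closed_setP => a b ab; rewrite !inE; apply/idP/idP => /connect_trans; apply;
  by apply: connect1; rewrite // adj_sym.
have xA : x \in A by rewrite inE connect0.
have yA : y \notin A by rewrite inE.
have cardA := cardsC A; rewrite card_ord in cardA.
have A1 : (0 < #|A|)%N by apply/card_gt0P; exists x.
have A2 : (0 < #|~: A|)%N by apply/card_gt0P; exists y; rewrite inE.
have -> : << t >> = mul_hom << iclass (induced (rep t) A) >>
    << iclass (induced (rep t) (~: A)) >>.
  rewrite mul_homU union_iclass; congr << _ >>; rewrite -{1}(rep_iclass t).
  exact/iclassP/iso_sym/induced_split.
have lt1 : (#|A| < #|A| + #|~: A|)%N by rewrite -addn1 leq_add2l.
have lt2 : (#|~: A| < #|A| + #|~: A|)%N by rewrite -add1n leq_add2r.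
rewrite cardA in lt1 lt2.
by rewrite m1 m2 !IHn // nverts_iclass card_sig;
  [apply: leq_trans lt2 tn | apply: leq_trans lt1 tn].
Qed.

Definition Delta_hom' : QG -> QG2 := sval (cid primitive_morphism_exists).

Lemma Delta_hom'P : primitive_morphism Delta_hom'.
Proof. exact: svalP (cid primitive_morphism_exists). Qed.

Definition dual_mul (D : QG -> QG2) : QG -> QG -> QG :=
  bilin_ext (fun s t => \sum_(g \in [set: isoclass])
    pairing (tens << s >> << t >>) (D << g >>) *: << g >>).

Definition mul_hom' := dual_mul Delta_hom'.
Definition mul_mono := dual_mul Delta_mono.
Definition mul_mono' := dual_mul Delta_mono'.
Definition mul_regmono := dual_mul Delta_regmono.
Definition mul_regmono' := dual_mul Delta_regmono'.

Definition connected_graded_hopf (mul : QG -> QG -> QG) (D : QG -> QG2) : Prop :=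
  [/\ hopf_algebra mul unit_map D counit, respects mul D vgrading
    & connected unit_map vgrading].

Definition connected_filtered_hopf (mul : QG -> QG -> QG) (D : QG -> QG2) : Prop :=
  [/\ hopf_algebra mul unit_map D counit, respects mul D vfiltration
    & connected unit_map vfiltration].

Definition bialgebra_without_antipode (mul : QG -> QG -> QG) (D : QG -> QG2) : Prop :=
  bialgebra mul unit_map D counit /\
  ~ exists S, antipode mul unit_map D counit S.

(* Main.v *)
(* A graph decomposes into a pair of subgraphs in three ways: as a union of two subgraphs
   (mono), as two induced subgraphs covering the vertices (regmono), or as a disjoint union
   (hom).  Summing [Y (x) Z] over the decompositions of a graph gives the three primed
   coproducts: every function counted by [Mcount] or [Rcount] is determined by its two images
   together with an identification of each of its two halves with its image, which accounts
   for the factors [Aut_card].  In this form coassociativity and compatibility with disjoint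
   union are statements about sets, so disjoint union forms a bialgebra with each of these
   coproducts.  Rescaling a graph by the order of its automorphism group turns a primed
   coproduct into the unprimed one and [mul_hom] into [mul_hom'], while taking adjoints for
   the pairing exchanges product and coproduct; this yields all ten bialgebras.  When the
   coproduct is [Delta_hom] or [Delta_hom'], it is graded and the antipode is defined by
   recursion on the number of vertices.  In part (3) the point [p] satisfies
   [Delta p = p (x) e + e (x) p + p (x) p], so an antipode would invert [e + p], which is
   killed by the character sending a graph with [n] vertices to [(-1)^n]. *)
From HB Require Import structures.
Require Import Defs.
From mathcomp Require Import finmap boolp classical_sets fsbigop monalg.
From mathcomp Require Import all_boot all_order all_algebra.

Set Implicit Arguments.
Unset Strict Implicit.
Unset Printing Implicit Defensive.

Import GRing.Theory.
Local Open Scope ring_scope.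

(** A subgraph is encoded as a set of cells, namely vertices [inl x] and ordered adjacent pairs
    [inr (x, y)], in one ambient finite type. All subgraphs of a graph then lie in a single Boolean
    algebra: union, intersection and restriction need no transport between vertex types, an iterated
    coproduct is a finite sum over triples of sets, and isomorphism enters only through [cl]. The
    record [rule] collects what the arguments use of a decomposition, so that the three kinds are
    treated at once. Taking adjoints is delicate in infinite dimension: a matrix with finite columns
    has a transpose between the same spaces only if its rows are finite too. For coproducts this is
    [locally_finite]: a graph has at most as many vertices as its two pieces together, so only
    finitely many graphs have a given pair of pieces. *)

Local Notation free K := {malg rat[K]}.
Local Notation QG := (free isoclass).
Local Notation QG2 := (free (isoclass * isoclass)%type).

(** * Subgraphs as sets of cells *)

Local Notation cell V := (V + V * V)%type.

Section Cells.
Variable V : finType.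
Implicit Types (X Y Z : {set cell V}) (e : simple_graph V).

(** These are the cell sets of simple graphs on a subset of [V]. One endpoint is enough, since the
    reversed pair supplies the other. *)
Definition wf X : bool :=
  [forall x, forall y, (inr (x, y) \in X) ==>
     [&& x != y, inl x \in X & inr (y, x) \in X]].

Lemma wfP X :
  reflect (forall x y, inr (x, y) \in X -> [/\ x != y, inl x \in X & inr (y, x) \in X])
    (wf X).
Proof.
apply: (iffP forallP) => [h x y xyX|h x].
  by have /forallP/(_ y)/implyP/(_ xyX)/and3P := h x.
by apply/forallP => y; apply/implyP => /h/and3P.
Qed.

Definition full e : {set cell V} :=
  finset (fun c => match c with inl _ => true | inr (x, y) => e x y end).

Lemma full_v e x : inl x \in full e. Proof. by rewrite inE. Qed.
Lemma full_e e x y : (inr (x, y) \in full e) = e x y. Proof. by rewrite inE. Qed.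

Lemma wf_full e : wf (full e).
Proof.
apply/wfP => x y; rewrite !inE adj_sym => exy; split=> //.
by apply: contraTneq exy => ->; rewrite adj_irr.
Qed.

(** Symmetry and irreflexivity are built into the relation, so that [graph_of] is total; on
    well-formed sets it is plain membership, by [graph_ofE]. *)
Definition cells_rel X : rel {x | inl x \in X} :=
  fun x y => [&& val x != val y, inr (val x, val y) \in X & inr (val y, val x) \in X].

Fact cells_sym X : symmetric (@cells_rel X).
Proof. by move=> x y; rewrite /cells_rel eq_sym; congr andb; rewrite andbC. Qed.

Fact cells_irr X : irreflexive (@cells_rel X).
Proof. by move=> x; rewrite /cells_rel eqxx. Qed.

Definition graph_of X := SimpleGraph (@cells_sym X) (@cells_irr X).

Definition cl X : isoclass := iclass (graph_of X).

Lemma graph_ofE X x y : wf X -> graph_of X x y = (inr (val x, val y) \in X).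
Proof.
move=> /wfP wX; rewrite /= /cells_rel; apply/and3P/idP => [[]//|xy].
by have [] := wX _ _ xy.
Qed.

Lemma wf0 : wf finset.set0. Proof. by apply/wfP => x y; rewrite inE. Qed.

Lemma cl0 : cl finset.set0 = eG.
Proof. by apply: void_iso; rewrite card_sig; apply: eq_card0 => x; rewrite !inE. Qed.

Lemma wfU Y Z : wf Y -> wf Z -> wf (Y :|: Z).
Proof.
move=> /wfP wY /wfP wZ; apply/wfP => x y; rewrite !inE.
by move=> /orP[/wY|/wZ] [-> -> ->]; rewrite ?orbT.
Qed.

Lemma cl_full e : cl (full e) = iclass e.
Proof.
apply/iclassP/isoP; exists val.
  apply: inj_card_bij; first exact: val_inj.
  by rewrite card_sig; apply/eq_leq/eq_card => x; rewrite !inE.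
by move=> x y; rewrite graph_ofE ?wf_full // full_e.
Qed.

End Cells.

Section Image.
Variables (V W : finType) (h : V -> W).
Hypothesis hi : injective h.
Implicit Types (X Y Z : {set cell V}).

Definition cmap (c : cell V) : cell W :=
  match c with inl x => inl (h x) | inr (x, y) => inr (h x, h y) end.

Lemma cmap_inj : injective cmap.
Proof. by move=> [x|[x y]] [x'|[x' y']] //= [] /hi -> // /hi ->. Qed.

Definition im X : {set cell W} := cmap @: X.

Lemma im_v X x : (inl (h x) \in im X) = (inl x \in X).
Proof. exact: (mem_imset X (inl x) cmap_inj). Qed.

Lemma im_e X x y : (inr (h x, h y) \in im X) = (inr (x, y) \in X).
Proof. exact: (mem_imset X (inr (x, y)) cmap_inj). Qed.

Lemma im_vP X w : inl w \in im X -> exists2 x, w = h x & inl x \in X.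
Proof. by move=> /imsetP[[x|[x y]] // xX [->]]; exists x. Qed.

Lemma im_eP X w w' : inr (w, w') \in im X ->
  exists x y, [/\ w = h x, w' = h y & inr (x, y) \in X].
Proof. by move=> /imsetP[[x|[x y]] // xX [-> ->]]; exists x, y. Qed.

Lemma im_inj : injective im. Proof. exact/imset_inj/cmap_inj. Qed.

Lemma wf_im X : wf (im X) = wf X.
Proof.
apply/wfP/wfP => wX x y.
  by rewrite -im_e => /wX; rewrite im_v im_e (inj_eq hi).
by move=> /im_eP[x' [y' [-> -> /wX]]]; rewrite im_v im_e (inj_eq hi).
Qed.

Lemma cl_im X : cl (im X) = cl X.
Proof.
apply/esym/iclassP/isoP.
have p (x : {x | inl x \in X}) : inl (h (val x)) \in im X by rewrite im_v (valP x).
exists (fun x => exist (fun y => inl y \in im X) (h (val x)) (p x)); last first.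
  by move=> x y; rewrite /= /cells_rel /= !im_e (inj_eq hi).
apply: inj_card_bij => [x y [/hi/val_inj]//|].
rewrite !card_sig.
rewrite -(card_image hi (fun x => inl x \in X)).
apply: subset_leq_card; apply/subsetP => w; rewrite inE => /im_vP[x -> xX].
by apply/imageP; exists x.
Qed.

(** Together with [pre_im], this matches subsets of [im X] with subsets of [X], which is how sums
    over decompositions are carried along an embedding. *)
Lemma im_pre (X : {set cell V}) (Y : {set cell W}) :
  Y \subset im X -> im (cmap @^-1: Y) = Y.
Proof.
move=> YX; apply/setP => c; apply/imsetP/idP => [[d]|cY].
  by rewrite inE => dY ->.
by have /imsetP[d dX cE] := subsetP YX _ cY; exists d => //; rewrite inE -cE.
Qed.

Lemma pre_im X : cmap @^-1: (im X) = X.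
Proof. by apply/setP => c; rewrite inE /im mem_imset //; apply: cmap_inj. Qed.

End Image.

(** Lets a subgraph be replaced by a graph on its own vertex type, embedded back by [val]. *)
Lemma im_val (V : finType) (X : {set cell V}) : wf X -> im val (full (graph_of X)) = X.
Proof.
move=> wX; have /wfP wX' := wX; apply/setP => c; apply/imsetP/idP => [[[x|[x y]]]|].
- by move=> _ -> /=; apply: (valP x).
- by rewrite full_e graph_ofE // => xy ->.
case: c => [x xX|[x y] xy]; first by exists (inl (exist _ x xX)); rewrite // full_v.
have [_ xX yx] := wX' _ _ xy; have [_ yX _] := wX' _ _ yx.
exists (inr (exist (fun x => inl x \in X) x xX, exist (fun x => inl x \in X) y yX)) => //.
by rewrite full_e graph_ofE.
Qed.

Lemma im_comp (V W T : finType) (h : V -> W) (g : W -> T) X :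
  im g (im h X) = im (g \o h) X.
Proof. by rewrite /im -imset_comp; apply: eq_imset => -[x|[x y]]. Qed.

Lemma eq_im (V W : finType) (h g : V -> W) X : h =1 g -> im h X = im g X.
Proof. by move=> hg; apply: eq_imset => -[x|[x y]] /=; rewrite !hg. Qed.

Lemma im_full_iso (V W : finType) (e : simple_graph V) (f : simple_graph W) :
  isomorphic e f -> exists2 h : V -> W, injective h & im h (full e) = full f.
Proof.
move=> /isoP[h [g hK gK] he]; exists h; first exact: can_inj hK.
apply/setP => -[w|[w w']]; rewrite -(gK w) ?im_v ?full_v //; try exact: can_inj hK.
by rewrite -(gK w') im_e ?full_e ?he //; apply: can_inj hK.
Qed.

(** Turns an equality of classes into an embedding of a model with prescribed image. *)
Lemma cl_eqP (V W : finType) (X : {set cell V}) (e : simple_graph W) :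
  wf X -> cl X = iclass e -> exists2 h : W -> V, injective h & im h (full e) = X.
Proof.
move=> wX /esym/iclassP/im_full_iso[h hi hE]; exists (val \o h).
  exact: inj_comp val_inj hi.
by rewrite -im_comp hE im_val.
Qed.

Lemma nverts_cl (V : finType) (X : {set cell V}) : nverts (cl X) = #|[pred x | inl x \in X]|.
Proof. by rewrite nverts_iclass card_sig. Qed.

(** * Cells of a disjoint union *)

Section DisjointCells.
Variables (V W : finType).

Definition dcells (X : {set cell V}) (Y : {set cell W}) : {set cell (V + W)} :=
  finset (fun c => match c with
    | inl (inl x) => inl x \in X
    | inl (inr y) => inl y \in Y
    | inr (inl x, inl x') => inr (x, x') \in X
    | inr (inr y, inr y') => inr (y, y') \in Y
    | _ => false
    end).

Lemma full_dunion (e : simple_graph V) (f : simple_graph W) :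
  full (dunion e f) = dcells (full e) (full f).
Proof. by apply/setP => -[[x|y]|[[x|y] [x'|y']]]; rewrite !inE. Qed.

(** No pair joins the two sides, so a subset of a disjoint union is recovered from its traces on
    them. *)
Lemma dcells_pre X Y (Z : {set cell (V + W)}) : Z \subset dcells X Y ->
  dcells (cmap inl @^-1: Z) (cmap inr @^-1: Z) = Z.
Proof.
move=> /subsetP ZXY; apply/setP => -[[x|y]|[[x|y] [x'|y']]]; rewrite !inE //=.
  by apply/esym/negbTE/negP => /ZXY; rewrite inE.
by apply/esym/negbTE/negP => /ZXY; rewrite inE.
Qed.

Lemma pre_dcellsl X Y : cmap inl @^-1: (dcells X Y) = X.
Proof. by apply/setP => -[x|[x x']]; rewrite !inE. Qed.

Lemma pre_dcellsr X Y : cmap inr @^-1: (dcells X Y) = Y.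
Proof. by apply/setP => -[x|[x x']]; rewrite !inE. Qed.

Lemma wf_dcells X Y : wf (dcells X Y) = wf X && wf Y.
Proof.
apply/wfP/andP => [w|[/wfP wX /wfP wY] [x|y] [x'|y']]; last 4 first.
- by rewrite !inE => /wX[? -> ->].
- by rewrite inE.
- by rewrite inE.
- by rewrite !inE => /wY[? -> ->].
split; apply/wfP => x y.
  by have := w (inl x) (inl y); rewrite !inE.
by have := w (inr x) (inr y); rewrite !inE.
Qed.

Lemma dcellsU X X' Y Y' : dcells X Y :|: dcells X' Y' = dcells (X :|: X') (Y :|: Y').
Proof. by apply/setP => -[[x|y]|[[x|y] [x'|y']]]; rewrite !inE. Qed.

Lemma dcellsI X X' Y Y' : dcells X Y :&: dcells X' Y' = dcells (X :&: X') (Y :&: Y').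
Proof. by apply/setP => -[[x|y]|[[x|y] [x'|y']]]; rewrite !inE. Qed.

Lemma dcells_eq X X' Y Y' : (dcells X Y == dcells X' Y') = (X == X') && (Y == Y').
Proof.
apply/eqP/andP => [E|[/eqP-> /eqP->]//]; split; apply/eqP.
  by rewrite -(pre_dcellsl X Y) E pre_dcellsl.
by rewrite -(pre_dcellsr X Y) E pre_dcellsr.
Qed.

Lemma dcells0 : dcells finset.set0 finset.set0 = finset.set0.
Proof. by apply/setP => -[[x|y]|[[x|y] [x'|y']]]; rewrite !inE. Qed.

End DisjointCells.

(** [union] is computed on graphs, so [X] and [Y] are first made graphs on their own vertices; the
    map [h] then embeds the disjoint union of these. *)
Lemma cl_dcells (V W : finType) (X : {set cell V}) (Y : {set cell W}) :
  wf X -> wf Y -> cl (dcells X Y) = union (cl X) (cl Y).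
Proof.
move=> wX wY; rewrite [in RHS]union_iclass -[RHS]cl_full full_dunion.
rewrite -[in LHS](im_val wX) -[in LHS](im_val wY).
set X' := full _; set Y' := full _.
pose h (c : {x | inl x \in X} + {y | inl y \in Y}) : V + W :=
  match c with inl x => inl (val x) | inr y => inr (val y) end.
have hi : injective h by move=> [x|y] [x'|y'] // [] /val_inj ->.
rewrite -(cl_im hi (dcells X' Y')); congr cl; apply/setP => c.
have vl : injective (fun x : {x | inl x \in X} => val x) := val_inj.
have vr : injective (fun x : {x | inl x \in Y} => val x) := val_inj.
apply/idP/idP.
  case: c => [[x|y]|[[x|y] [x'|y']]]; rewrite inE // => /imsetP[].
  - by move=> [a|[a b]] // aX [->]; apply/imsetP; exists (inl (inl a)); rewrite ?inE.
  - by move=> [a|[a b]] // aX [->]; apply/imsetP; exists (inl (inr a)); rewrite ?inE.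
  - move=> [a|[a b]] // aX [-> ->]; apply/imsetP; exists (inr (inl a, inl b)) => //.
    by rewrite inE.
  - move=> [a|[a b]] // aX [-> ->]; apply/imsetP; exists (inr (inr a, inr b)) => //.
    by rewrite inE.
move=> /imsetP[[[x|y]|[[x|y] [x'|y']]]]; rewrite inE // => aX ->; rewrite inE /=.
- by rewrite im_v.
- by rewrite im_v.
- by rewrite im_e.
- by rewrite im_e.
Qed.

(** * Decomposition rules *)

(* [splits X Y Z]: the subgraph [X] decomposes into its subgraphs [Y] and [Z].
   [splits_rot] is coassociativity: both sides count the ways of decomposing [X] into
   [U], [W] and [Z], up to [splitsC]. *)
Record rule := Rule {
  splits : forall V : finType, {set cell V} -> {set cell V} -> {set cell V} -> bool;
  splits_sub : forall (V : finType) (X Y Z : {set cell V}), wf X -> splits X Y Z ->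
    [/\ wf Y, wf Z, Y \subset X & Z \subset X];
  splits_cover : forall (V : finType) (X Y Z : {set cell V}) x, wf X -> splits X Y Z ->
    inl x \in X -> (inl x \in Y) || (inl x \in Z);
  splits_im : forall (V W : finType) (h : V -> W), injective h -> forall X Y Z : {set cell V},
    splits (im h X) (im h Y) (im h Z) = splits X Y Z;
  splitsC : forall (V : finType) (X Y Z : {set cell V}), splits X Y Z = splits X Z Y;
  splits0 : forall (V : finType) (X Z : {set cell V}), wf X ->
    splits X finset.set0 Z = (Z == X);
  splits_rot : forall (V : finType) (X U W Z : {set cell V}), wf X ->
    #|[pred Y | splits X Y Z && splits Y U W]| = #|[pred Y | splits X Y U && splits Y W Z]|;
  splits_dcells : forall (V W : finType) (X Y Z : {set cell V}) (X' Y' Z' : {set cell W}),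
    splits (dcells X X') (dcells Y Y') (dcells Z Z') = splits X Y Z && splits X' Y' Z'
}.

(** In all three rules the middle set of an iterated decomposition is determined by the outer
    pieces. Both sides of [splits_rot] are therefore 0 or 1, and it remains to compare two
    conditions on the three pieces. *)
Lemma card_pred1_and (T : finType) (P : pred T) (a : T) (b : bool) :
  (forall x, P x = (x == a) && b) -> #|[pred x | P x]| = b.
Proof.
move=> Pa; case: b Pa => Pa.
  by apply: etrans (card1 a); apply: eq_card => x; rewrite !inE Pa andbT.
by apply: eq_card0 => x; rewrite inE Pa andbF.
Qed.

(** * The rules: unions, disjoint unions, and induced covers *)

Section Union.
Variable V : finType.
Implicit Types X Y Z U W : {set cell V}.

Definition splits_mono X Y Z := [&& wf Y, wf Z & X == Y :|: Z].

Lemma splits_mono_sub X Y Z : wf X -> splits_mono X Y Z ->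
  [/\ wf Y, wf Z, Y \subset X & Z \subset X].
Proof. by move=> _ /and3P[wY wZ /eqP->]; rewrite subsetUl subsetUr. Qed.

Lemma splits_monoC X Y Z : splits_mono X Y Z = splits_mono X Z Y.
Proof. by rewrite /splits_mono finset.setUC andbCA. Qed.

Lemma splits_mono0 X Z : wf X -> splits_mono X finset.set0 Z = (Z == X).
Proof.
move=> wX; rewrite /splits_mono wf0 finset.set0U eq_sym /=.
by case: eqP => [->|]; rewrite ?andbF ?wX.
Qed.

Lemma splits_mono_rot X U W Z : wf X ->
  #|[pred Y | splits_mono X Y Z && splits_mono Y U W]| =
  #|[pred Y | splits_mono X Y U && splits_mono Y W Z]|.
Proof.
(* Both counts equal the truth value of [b], a condition symmetric in the three pieces; the middle
   set is [U :|: W] on the left and [W :|: Z] on the right. *)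
move=> wX; pose b := [&& wf U, wf W, wf Z & X == U :|: W :|: Z].
rewrite (card_pred1_and (a := U :|: W) (b := b)); last first.
  move=> Y; rewrite /splits_mono; case: (Y =P U :|: W) => [->|]; last by rewrite !andbF.
  rewrite andbT /b; case: (boolP (wf U)) => wU; rewrite /= ?andbF //.
  by case: (boolP (wf W)) => wW; rewrite /= ?andbF // wfU // ?andbT.
rewrite (card_pred1_and (a := W :|: Z) (b := b)) //.
move=> Y; rewrite /splits_mono; case: (Y =P W :|: Z) => [->|]; last by rewrite !andbF.
rewrite andbT /b [(W :|: Z) :|: U]finset.setUC finset.setUA.
case: (boolP (wf W)) => wW; rewrite /= ?andbF //.
by case: (boolP (wf Z)) => wZ; rewrite /= ?andbF // wfU // ?andbT // andbC.
Qed.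

(** Well-formed pieces with no common cell have disjoint vertex sets. An edge of [X] lies in one of
    them with both its ends, so no edge joins them: both are unions of components. *)
Definition splits_hom X Y Z := splits_mono X Y Z && (Y :&: Z == finset.set0).

Lemma splits_homC X Y Z : splits_hom X Y Z = splits_hom X Z Y.
Proof. by rewrite /splits_hom splits_monoC finset.setIC. Qed.

Lemma splits_hom0 X Z : wf X -> splits_hom X finset.set0 Z = (Z == X).
Proof. by move=> wX; rewrite /splits_hom splits_mono0 // finset.set0I eqxx andbT. Qed.

Lemma splits_hom_rot X U W Z : wf X ->
  #|[pred Y | splits_hom X Y Z && splits_hom Y U W]| =
  #|[pred Y | splits_hom X Y U && splits_hom Y W Z]|.
Proof.
move=> wX; pose b := [&& wf U, wf W, wf Z, X == U :|: W :|: Z, U :&: W == finset.set0,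
  U :&: Z == finset.set0 & W :&: Z == finset.set0].
rewrite (card_pred1_and (a := U :|: W) (b := b)); last first.
  move=> Y; rewrite /splits_hom /splits_mono.
  case: (Y =P U :|: W) => [->|]; last by rewrite !andbF.
  rewrite andbT /b finset.setIUl setU_eq0.
  case: (boolP (wf U)) => wU; rewrite /= ?andbF //.
  case: (boolP (wf W)) => wW; rewrite /= ?andbF // wfU //=.
  by case: (wf Z) (_ == _) (_ == _) (_ == _) (_ == _) => [] [] [] [] [].
rewrite (card_pred1_and (a := W :|: Z) (b := b)) //.
move=> Y; rewrite /splits_hom /splits_mono.
case: (Y =P W :|: Z) => [->|]; last by rewrite !andbF.
rewrite andbT /b finset.setIUl setU_eq0 [(W :|: Z) :|: U]finset.setUC finset.setUA.
rewrite [W :&: U]finset.setIC [Z :&: U]finset.setIC.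
case: (boolP (wf W)) => wW; rewrite /= ?andbF //.
case: (boolP (wf Z)) => wZ; rewrite /= ?andbF // wfU //=.
by case: (wf U) (_ == _) (_ == _) (_ == _) (_ == _) => [] [] [] [] [].
Qed.

(** The subgraph of [X] induced on those of its vertices that lie in [Y]; the induced subgraphs of
    [X] are the fixed points of [ind X]. *)
Definition ind X Y : {set cell V} := finset (fun c => (c \in X) &&
  match c with inl x => inl x \in Y | inr (x, y) => (inl x \in Y) && (inl y \in Y) end).

Definition splits_regmono X Y Z :=
  [&& Y == ind X Y, Z == ind X Z
    & [forall x, (inl x \in X) ==> (inl x \in Y) || (inl x \in Z)]].

Lemma wf_ind X Y : wf X -> wf (ind X Y).
Proof.
move=> /wfP wX; apply/wfP => x y; rewrite !inE => /and3P[/wX[-> -> ->] -> ->].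
by [].
Qed.

Lemma ind_sub X Y : ind X Y \subset X.
Proof. by apply/subsetP => c; rewrite inE => /andP[]. Qed.

Lemma splits_regmono_sub X Y Z : wf X -> splits_regmono X Y Z ->
  [/\ wf Y, wf Z, Y \subset X & Z \subset X].
Proof. by move=> wX /and3P[/eqP-> /eqP-> _]; rewrite !wf_ind ?ind_sub. Qed.

Lemma splits_regmonoC X Y Z : splits_regmono X Y Z = splits_regmono X Z Y.
Proof.
rewrite /splits_regmono andbCA; do 2 congr andb.
by apply: eq_forallb => x; rewrite orbC.
Qed.

Lemma ind_eqP X Y : reflect
  [/\ forall x, inl x \in Y -> inl x \in X
    & forall x y, (inr (x, y) \in Y) =
        [&& inr (x, y) \in X, inl x \in Y & inl y \in Y]] (Y == ind X Y).
Proof.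
apply: (iffP eqP) => [YE|[h1 h2]].
  split=> [x|x y]; first by rewrite YE inE => /andP[].
  by rewrite {1}YE inE.
apply/setP => -[x|[x y]]; rewrite inE ?h2 //.
by case: (boolP (inl x \in Y)) => [/h1->|]; rewrite ?andbF.
Qed.

Lemma splits_regmono0 X Z : wf X -> splits_regmono X finset.set0 Z = (Z == X).
Proof.
move=> wX; apply/and3P/eqP => [[_ /ind_eqP[h1 h2] /forallP cov]|->].
  have zX x : (inl x \in Z) = (inl x \in X).
    apply/idP/idP => [/h1//|xX].
    by have /implyP/(_ xX) := cov x; rewrite inE.
  apply/setP => -[x|[x y]]; first exact: zX.
  rewrite h2 !zX; case: (boolP (inr (x, y) \in X)) => //= xy.
  have /wfP wX' := wX.
  by have [_ -> /wX'[_ -> _]] := wX' _ _ xy.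
split.
- by apply/ind_eqP; split=> [x|x y]; rewrite !inE ?andbF.
- apply/ind_eqP; split=> // x y; case: (boolP (inr (x, y) \in X)) => //= xy.
  have /wfP wX' := wX.
  by have [_ -> /wX'[_ -> _]] := wX' _ _ xy.
by apply/forallP => x; apply/implyP => ->; rewrite orbT.
Qed.

(** Being induced is transitive, and a subgraph of an induced [Y] that is induced in [X] is induced
    in [Y]. Hence both counts say that the three pieces are induced in [X] and cover its
    vertices. *)
Lemma splits_regmono_rot X U W Z : wf X ->
  #|[pred Y | splits_regmono X Y Z && splits_regmono Y U W]| =
  #|[pred Y | splits_regmono X Y U && splits_regmono Y W Z]|.
Proof.
move=> _.
pose b U W Z := [&& U == ind X U, W == ind X W, Z == ind X Z &
  [forall x, (inl x \in X) ==> [|| inl x \in U, inl x \in W | inl x \in Z]]].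
(* [b] is invariant under rotation of its arguments, and the two sides are the counts for
   [(U, W, Z)] and [(W, Z, U)]. *)
suff count U' W' Z' :
    #|[pred Y | splits_regmono X Y Z' && splits_regmono Y U' W']| = b U' W' Z'.
  rewrite (count U W Z) (count W Z U); congr nat_of_bool.
  rewrite /b; do 3 (case: (_ == _); rewrite ?andbF //=).
  by apply: eq_forallb => x; rewrite [in RHS]orbA [in RHS]orbC.
(* A bare union of induced subgraphs need not be induced: edges of [X] between the two may be
   missing, so the middle set is the induced closure. *)
apply: (card_pred1_and (a := ind X (U' :|: W'))) => Y.
apply/andP/andP => [[/and3P[/ind_eqP[vY eY] /ind_eqP[vZ eZ] /forallP cX]
    /and3P[/ind_eqP[vU eU] /ind_eqP[vW eW] /forallP cY]]|].
  have YE x : (inl x \in Y) = (inl x \in U') || (inl x \in W').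
    by apply/idP/orP => [xY|[/vU|/vW]//]; apply/orP; have /implyP/(_ xY) := cY x.
  split.
    apply/eqP/setP => -[x|[x y]]; rewrite !inE -?YE ?eY //.
    by case: (boolP (inl x \in Y)) => [/vY->|]; rewrite ?andbF.
  apply/and4P; split.
  - apply/ind_eqP; split=> [x /vU/vY//|x y]; rewrite eU eY !YE.
    by case: (_ \in X) (_ \in U') (_ \in U') => [] [] []; rewrite ?andbF ?orbT.
  - apply/ind_eqP; split=> [x /vW/vY//|x y]; rewrite eW eY !YE.
    by case: (_ \in X) (_ \in W') (_ \in W') => [] [] []; rewrite ?andbF ?orbT.
  - by apply/ind_eqP.
  by apply/forallP => x; apply/implyP => xX; have /implyP/(_ xX) := cX x; rewrite YE -orbA.
move=> [/eqP-> /and4P[/ind_eqP[vU eU] /ind_eqP[vW eW] /ind_eqP[vZ eZ] /forallP cX]].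
have YE x : (inl x \in ind X (U' :|: W')) = (inl x \in U') || (inl x \in W').
  rewrite !inE; case: (boolP (inl x \in U')) => [/vU->//|_] /=.
  by case: (boolP (inl x \in W')) => [/vW->//|_]; rewrite andbF.
split; apply/and3P; split.
- apply/ind_eqP; split=> [x|x y]; first by rewrite YE => /orP[/vU|/vW].
  by rewrite !YE !inE.
- exact/ind_eqP.
- by apply/forallP => x; apply/implyP => xX; have /implyP/(_ xX) := cX x; rewrite YE -orbA.
- apply/ind_eqP; split=> [x|x y]; first by rewrite YE => ->.
  rewrite inE /= eU !inE.
  by case: (_ \in X) (_ \in U') (_ \in U') => [] [] []; rewrite ?andbF ?orbT.
- apply/ind_eqP; split=> [x|x y]; first by rewrite YE orbC => ->.
  rewrite inE /= eW !inE.
  by case: (_ \in X) (_ \in W') (_ \in W') => [] [] []; rewrite ?andbF ?orbT.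
by apply/forallP => x; apply/implyP; rewrite YE.
Qed.

End Union.

(** * Invariance of the rules under embeddings and disjoint unions *)

Section RuleImage.
Variables (V W : finType) (h : V -> W).
Hypothesis hi : injective h.
Implicit Types (X Y Z : {set cell V}).

Lemma splits_mono_im X Y Z :
  splits_mono (im h X) (im h Y) (im h Z) = splits_mono X Y Z.
Proof. by rewrite /splits_mono !wf_im // -imsetU (inj_eq (im_inj hi)). Qed.

Lemma splits_hom_im X Y Z :
  splits_hom (im h X) (im h Y) (im h Z) = splits_hom X Y Z.
Proof.
rewrite /splits_hom splits_mono_im -imsetI; last by move=> x y _ _; apply: cmap_inj.
by rewrite -[in LHS](imset0 (cmap h)) (inj_eq (im_inj hi)).
Qed.

Lemma ind_im X Y : ind (im h X) (im h Y) = im h (ind X Y).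
Proof.
apply/setP => c; rewrite inE; apply/andP/idP => [[/imsetP[d dX ->] cY]|].
  apply/imsetP; exists d => //; rewrite inE dX.
  by case: d {dX} cY => [x|[x y]] /=; rewrite !im_v.
move=> /imsetP[d]; rewrite inE => /andP[dX dY] ->; split; first exact: imset_f.
by case: d dY {dX} => [x|[x y]] /=; rewrite !im_v.
Qed.

Lemma splits_regmono_im X Y Z :
  splits_regmono (im h X) (im h Y) (im h Z) = splits_regmono X Y Z.
Proof.
rewrite /splits_regmono !ind_im !(inj_eq (im_inj hi)); do 2 congr andb.
apply/forallP/forallP => cX x.
  by have := cX (h x); rewrite !im_v.
by apply/implyP => /im_vP[y -> yX]; have /implyP/(_ yX) := cX y; rewrite !im_v.
Qed.

End RuleImage.

Section RuleDisjoint.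
Variables (V W : finType).

Lemma splits_mono_dcells (X Y Z : {set cell V}) (X' Y' Z' : {set cell W}) :
  splits_mono (dcells X X') (dcells Y Y') (dcells Z Z') =
  splits_mono X Y Z && splits_mono X' Y' Z'.
Proof. by rewrite /splits_mono !wf_dcells dcellsU dcells_eq -!andbA; do !bool_congr. Qed.

Lemma splits_hom_dcells (X Y Z : {set cell V}) (X' Y' Z' : {set cell W}) :
  splits_hom (dcells X X') (dcells Y Y') (dcells Z Z') =
  splits_hom X Y Z && splits_hom X' Y' Z'.
Proof.
by rewrite /splits_hom splits_mono_dcells dcellsI -dcells0 dcells_eq -!andbA; do !bool_congr.
Qed.

Lemma splits_regmono_dcells (X Y Z : {set cell V}) (X' Y' Z' : {set cell W}) :
  splits_regmono (dcells X X') (dcells Y Y') (dcells Z Z') =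
  splits_regmono X Y Z && splits_regmono X' Y' Z'.
Proof.
have indE A A' B B' :
    ind (dcells A A') (dcells B B') = dcells (ind A B) (ind A' B') :> {set cell (V + W)}.
  by apply/setP => -[[x|y]|[[x|y] [x'|y']]]; rewrite !inE.
rewrite /splits_regmono !indE !dcells_eq.
have -> : [forall x, (inl x \in dcells X X') ==>
      (inl x \in dcells Y Y') || (inl x \in dcells Z Z')] =
    [forall x, (inl x \in X) ==> (inl x \in Y) || (inl x \in Z)] &&
    [forall x, (inl x \in X') ==> (inl x \in Y') || (inl x \in Z')].
  apply/forallP/andP => [h|[/forallP h /forallP h'] [x|x]].
  - by split; apply/forallP => x; [have := h (inl x)|have := h (inr x)]; rewrite !inE.
  - by have := h x; rewrite !inE.
  - by have := h' x; rewrite !inE.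
by rewrite -!andbA; do !bool_congr.
Qed.

End RuleDisjoint.

Lemma splits_mono_cover (V : finType) (X Y Z : {set cell V}) x :
  wf X -> splits_mono X Y Z -> inl x \in X -> (inl x \in Y) || (inl x \in Z).
Proof. by move=> _ /and3P[_ _ /eqP->]; rewrite inE. Qed.

Lemma splits_hom_sub (V : finType) (X Y Z : {set cell V}) :
  wf X -> splits_hom X Y Z -> [/\ wf Y, wf Z, Y \subset X & Z \subset X].
Proof. by move=> wX /andP[+ _]; apply: splits_mono_sub. Qed.

Lemma splits_hom_cover (V : finType) (X Y Z : {set cell V}) x :
  wf X -> splits_hom X Y Z -> inl x \in X -> (inl x \in Y) || (inl x \in Z).
Proof. by move=> wX /andP[+ _]; apply: splits_mono_cover. Qed.

Lemma splits_regmono_cover (V : finType) (X Y Z : {set cell V}) x :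
  wf X -> splits_regmono X Y Z -> inl x \in X -> (inl x \in Y) || (inl x \in Z).
Proof. by move=> wX /and3P[_ _ /forallP/(_ x)/implyP]. Qed.

Definition mono_rule := Rule splits_mono_sub splits_mono_cover splits_mono_im
  splits_monoC splits_mono0 splits_mono_rot splits_mono_dcells.

Definition hom_rule := Rule splits_hom_sub splits_hom_cover splits_hom_im
  splits_homC splits_hom0 splits_hom_rot splits_hom_dcells.

Definition regmono_rule := Rule splits_regmono_sub splits_regmono_cover splits_regmono_im
  splits_regmonoC splits_regmono0 splits_regmono_rot splits_regmono_dcells.

(** * The coproduct of a rule *)

Lemma lin_ext_sum (K : choiceType) (W : lmodType rat) (f : K -> W) (I : finType)
    (Q : pred I) (F : I -> free K) :
  lin_ext f (\sum_(i | Q i) F i) = \sum_(i | Q i) lin_ext f (F i).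
Proof. exact: raddf_sum. Qed.

Lemma linear_ext (K : choiceType) (W : lmodType rat) (f g : free K -> W) :
  linear f -> linear g -> (forall k, f << k >> = g << k >>) -> forall x, f x = g x.
Proof.
move=> lf lg; pose F : {linear free K -> W} := HB.pack f (GRing.isLinear.Build _ _ _ _ _ lf).
pose G : {linear free K -> W} := HB.pack g (GRing.isLinear.Build _ _ _ _ _ lg).
exact: (@basis_ext _ _ F G).
Qed.

Lemma tens_map_linear (K K' L L' : choiceType) (f : free K -> free K') (g : free L -> free L') :
  linear (tens_map f g).
Proof. exact: lin_ext_linear. Qed.

Lemma tens_assoc_linear (K : choiceType) : linear (@tens_assoc K).
Proof. exact: lin_ext_linear. Qed.

Lemma tens_mapU (K K' L L' : choiceType) (f : free K -> free K') (g : free L -> free L') k l :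
  tens_map f g << (k, l) >> = tens (f << k >>) (g << l >>).
Proof. exact: lin_extU. Qed.

Section Splitting.
Variable P : rule.

Definition split_sum (V : finType) (X : {set cell V}) : QG2 :=
  \sum_(p : {set cell V} * {set cell V} | splits P X p.1 p.2) << (cl p.1, cl p.2) >>.

Lemma split_sum_im (V W : finType) (h : V -> W) (X : {set cell V}) :
  injective h -> wf X -> split_sum (im h X) = split_sum X.
Proof.
move=> hi wX; rewrite /split_sum.
rewrite (reindex_onto (fun p : {set cell V} * {set cell V} => (im h p.1, im h p.2))
  (fun p => (cmap h @^-1: p.1, cmap h @^-1: p.2))) /=; last first.
  move=> [Y Z] /= PYZ; have [_ _ sY sZ] := splits_sub (etrans (wf_im hi X) wX) PYZ.
  by rewrite (im_pre sY) (im_pre sZ).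
apply: eq_big => [[Y Z]|[Y Z] _] /=.
  by rewrite splits_im // !pre_im // eqxx andbT.
by rewrite !cl_im.
Qed.

Definition delta : QG -> QG2 := lin_ext (fun t => split_sum (full (rep t))).

Lemma deltaU t : delta << t >> = split_sum (full (rep t)).
Proof. exact: lin_extU. Qed.

(** The coproduct may be computed in any model of the class, in particular on a subgraph inside its
    ambient graph; this is what makes iterated coproducts sums over subgraphs of one graph. *)
Lemma delta_cl (V : finType) (X : {set cell V}) : wf X -> delta << cl X >> = split_sum X.
Proof.
move=> wX; rewrite deltaU.
have [h hi hX] := cl_eqP wX (esym (rep_iclass (cl X))).
by rewrite -[in RHS]hX split_sum_im ?wf_full.
Qed.

Lemma delta_iclass (V : finType) (e : simple_graph V) :
  delta << iclass e >> = split_sum (full e).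
Proof. by rewrite -cl_full delta_cl ?wf_full. Qed.

Lemma delta_linear : linear delta. Proof. exact: lin_ext_linear. Qed.

(** Collects the terms by the final triple of pieces; the multiplicity is the number of middle sets,
    the quantity that [splits_rot] controls. *)
Lemma iterated_split_sum (V : finType) (X : {set cell V}) (W : lmodType rat)
    (F : {set cell V} -> {set cell V} -> {set cell V} -> W) :
  \sum_(p | splits P X p.1 p.2) \sum_(q | splits P p.1 q.1 q.2) F q.1 q.2 p.2 =
  \sum_(r : {set cell V} * {set cell V} * {set cell V})
    F r.1.1 r.1.2 r.2 *+ #|[pred Y | splits P X Y r.2 && splits P Y r.1.1 r.1.2]|.
Proof.
rewrite pair_big_dep /=.
pose S := {set cell V}.
rewrite (reindex (fun y : S * (S * S * S) => ((y.1, y.2.2), y.2.1))) /=; last first.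
  exists (fun p : (S * S) * (S * S) => (p.1.1, (p.2, p.1.2))).
    by move=> [Y [[U U'] Z]].
  by move=> [[Y Z] [U U']].
rewrite -(pair_big_dep xpredT
  (fun (Y : S) (r : S * S * S) => splits P X Y r.2 && splits P Y r.1.1 r.1.2)
  (fun _ r => F r.1.1 r.1.2 r.2)) /=.
rewrite (exchange_big_dep xpredT) //=; apply: eq_bigr => r _.
by rewrite sumr_const.
Qed.

Lemma delta_coassoc x :
  tens_assoc (tens_map delta id (delta x)) = tens_map id delta (delta x).
Proof.
move: x; apply: linear_ext => [||t].
- exact: linear_comp (linear_comp delta_linear (tens_map_linear _ _)) (@tens_assoc_linear _).
- exact: linear_comp delta_linear (tens_map_linear _ _).
rewrite deltaU; move: (rep t) => e; set X := full e; have wX : wf X := wf_full e.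
rewrite /split_sum /tens_assoc [tens_map delta id _]lin_ext_sum lin_ext_sum.
rewrite [RHS]lin_ext_sum.
transitivity (\sum_(p | splits P X p.1 p.2) \sum_(q | splits P p.1 q.1 q.2)
    << (cl q.1, (cl q.2, cl p.2)) >> : free (isoclass * (isoclass * isoclass))%type).
  apply: eq_bigr => -[Y Z] /= PYZ; have [wY wZ _ _] := splits_sub wX PYZ.
  rewrite lin_extU /= delta_cl // /split_sum /tens bilin_ext_suml lin_ext_sum.
  by apply: eq_bigr => -[U W] _; rewrite bilin_extU lin_extU.
(* The right-hand side splits the second factor again, whereas [iterated_split_sum] splits the
   first. Exchanging the factors by [splitsC] puts the piece left whole in front, and a cyclic
   relabelling of the triple then meets [splits_rot]. *)
transitivity (\sum_(p | splits P X p.1 p.2) \sum_(q | splits P p.1 q.1 q.2)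
    << (cl p.2, (cl q.1, cl q.2)) >> : free (isoclass * (isoclass * isoclass))%type).
  pose S := {set cell 'I_(nverts t)}.
  pose F (U W Z : S) : free (isoclass * (isoclass * isoclass))%type :=
    << (cl U, (cl W, cl Z)) >>.
  rewrite (iterated_split_sum X F) (iterated_split_sum X (fun U W Z => F Z U W)).
  rewrite [RHS](reindex (fun y : S * S * S => (y.1.2, y.2, y.1.1))) /=; last first.
    by exists (fun y : S * S * S => (y.2, y.1.1, y.1.2)) => -[[? ?] ?].
  by apply: eq_bigr => -[[U W] Z] _ /=; rewrite splits_rot.
rewrite [RHS](reindex (fun y : {set cell 'I_(nverts t)} * {set cell 'I_(nverts t)} =>
  (y.2, y.1))) /=; last first.
  by exists (fun y => (y.2, y.1)) => -[? ?].
apply: eq_big => [[Y Z]|[Y Z] /= PYZ]; first by rewrite splitsC.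
have [wY wZ _ _] := splits_sub wX PYZ.
rewrite lin_extU /= delta_cl // /split_sum /tens bilin_ext_sumr.
by apply: eq_bigr => -[U W] _; rewrite bilin_extU.
Qed.

(** A well-formed set without vertices has no edges either. *)
Lemma cl_eG (V : finType) (X : {set cell V}) : wf X -> (cl X == eG) = (X == finset.set0).
Proof.
move=> /wfP wX; apply/eqP/eqP => [X0|->]; last exact: cl0.
have vX x : inl x \in X = false.
  apply/negbTE/negP => xX; have := nverts_cl X; rewrite X0 nverts_iclass card_void.
  by move=> /esym/card0_eq/(_ x); rewrite inE /= xX.
apply/setP => -[x|[x y]]; rewrite inE ?vX //.
by apply/negbTE/negP => /wX[_]; rewrite vX.
Qed.

Lemma delta_counit x : lin_ext (fun p => counit << p.1 >> *: << p.2 >>) (delta x) = x.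
Proof.
move: x; apply: linear_ext => [||t] //.
  exact: linear_comp delta_linear (lin_ext_linear _).
rewrite deltaU lin_ext_sum; set X := full _; have wX : wf X := wf_full _.
rewrite (bigD1 (finset.set0, X)) /=; last by rewrite splits0.
rewrite lin_extU cl0 /counit mcoeffUU scale1r cl_full rep_iclass big1 ?addr0 //.
move=> [Y Z] /= /andP[PYZ nYZ]; have [wY _ _ _] := splits_sub wX PYZ.
rewrite lin_extU mcoeffU cl_eG //; case: eqP => [Y0|]; last by rewrite scale0r.
by move: PYZ nYZ; rewrite Y0 splits0 // => /eqP->; rewrite eqxx.
Qed.

Lemma delta_cocomm x : lin_ext (fun p => << (p.2, p.1) >>) (delta x) = delta x.
Proof.
move: x; apply: linear_ext => [||t].
- exact: linear_comp delta_linear (lin_ext_linear _).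
- exact: delta_linear.
rewrite deltaU lin_ext_sum /split_sum.
rewrite (reindex (fun y => (y.2, y.1))) /=; last by exists (fun y => (y.2, y.1)) => -[? ?].
by apply: eq_big => [[Y Z]|[Y Z] _]; rewrite ?lin_extU // splitsC.
Qed.

(** A decomposition of a disjoint union is a pair of decompositions: the pieces separate by
    [dcells_pre] and the rule by [splits_dcells]. *)
Lemma delta_mul x y : delta (mul_hom x y) = tens_mul mul_hom (delta x) (delta y).
Proof.
move: x y; apply: bilin_basis_ext => [y|x|y|x|s t].
- by apply: linear_comp delta_linear; apply: bilin_ext_linearl.
- by apply: linear_comp delta_linear; apply: bilin_ext_linearr.
- by apply: linear_comp; [apply: delta_linear|apply: tens_mul_linearl].
- by apply: linear_comp; [apply: delta_linear|apply: tens_mul_linearr].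
rewrite mul_homU /union delta_iclass !deltaU full_dunion.
move: (rep s) (rep t) => e f; have we := wf_full e; have wf := wf_full f.
rewrite {1}/split_sum.
pose S := {set cell 'I_(nverts s)}; pose T := {set cell 'I_(nverts t)}.
rewrite (reindex_onto (fun p : (S * S) * (T * T) => (dcells p.1.1 p.2.1, dcells p.1.2 p.2.2))
  (fun p => ((cmap inl @^-1: p.1, cmap inl @^-1: p.2),
             (cmap inr @^-1: p.1, cmap inr @^-1: p.2)))) /=; last first.
  move=> [Y Z] /= PYZ.
  have [|_ _ sY sZ] := splits_sub _ PYZ; first by rewrite wf_dcells we wf.
  by rewrite (dcells_pre sY) (dcells_pre sZ).
rewrite /split_sum /tens_mul bilin_ext_suml.
under [RHS]eq_bigr do rewrite bilin_ext_sumr.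
rewrite pair_big_dep /=.
apply: eq_big => [[[Y Z] [Y' Z']]|[[Y Z] [Y' Z']]] /=.
  by rewrite splits_dcells !pre_dcellsl !pre_dcellsr eqxx andbT.
rewrite splits_dcells => /andP[/andP[PYZ PYZ'] _].
have [wY wZ _ _] := splits_sub we PYZ; have [wY' wZ' _ _] := splits_sub wf PYZ'.
by rewrite -[RHS]/(tens_mul mul_hom _ _) tens_mul_homU !cl_dcells.
Qed.

Lemma delta_unit : delta << eG >> = tens << eG >> << eG >>.
Proof.
rewrite -(cl0 void) delta_cl ?wf0 // tensU /split_sum.
have all0 (X : {set cell void}) : X = finset.set0.
  by apply/setP => -[[]|[[]]].
rewrite (big_pred1 (finset.set0, finset.set0)) // => -[Y Z] /=.
by rewrite (all0 Y) (all0 Z) splits0 ?wf0 // !eqxx.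
Qed.

End Splitting.

(** * Counting embeddings *)

Section Embeddings.
Variables (V W : finType) (e : simple_graph V).

Definition embeddings (Y : {set cell W}) : {pred {ffun V -> W}} :=
  [pred h : {ffun V -> W} | injectiveb h && (im h (full e) == Y)].

Lemma is_isoE (f : simple_graph W) (h : {ffun V -> W}) :
  is_iso e f h = (h \in embeddings (full f)).
Proof.
rewrite inE /is_iso /is_regmono -andbA; have [hi|//] := injectiveP h; rewrite !andTb.
apply/andP/eqP => [[/forallP he /forallP hs]|E].
  apply/setP => -[w|[w w']].
    by rewrite full_v; have /existsP[v /eqP<-] := hs w; rewrite im_v ?full_v.
  have /existsP[v /eqP<-] := hs w; have /existsP[v' /eqP<-] := hs w'.
  by rewrite im_e // !full_e; have /forallP/(_ v')/eqP := he v.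
split; apply/forallP => x.
  by apply/forallP => y; apply/eqP; rewrite -full_e -[RHS]full_e -E im_e.
apply/existsP; have : inl x \in im h (full e) by rewrite E full_v.
by move=> /im_vP[v -> _]; exists v.
Qed.

End Embeddings.

(** The embeddings with a given image form a torsor under the automorphism group: any of them
    factors uniquely through [h0]. *)
Lemma card_embeddings (V W : finType) (e : simple_graph V) (Y : {set cell W}) h0 :
  h0 \in embeddings e Y -> #|embeddings e Y| = aut_order e.
Proof.
rewrite inE => /andP[/injectiveP hi /eqP hY].
pose c (a : {ffun V -> V}) : {ffun V -> W} := [ffun x => h0 (a x)].
have c_inj : injective c.
  by move=> a b /ffunP ab; apply/ffunP => x; have := ab x; rewrite !ffunE => /hi.
have cE (a : {ffun V -> V}) : injective a -> im (c a) (full e) = im h0 (im a (full e)).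
  by move=> ai; rewrite im_comp; apply: eq_im => x; rewrite ffunE.
rewrite /aut_order -(card_image c_inj); apply: eq_card => h.
apply/idP/imageP => [|[a]]; last first.
  rewrite inE is_isoE inE => /andP[/injectiveP ai /eqP aE] ->; rewrite inE cE // aE hY eqxx andbT.
  by apply/injectiveP => x y; rewrite !ffunE => /hi/ai.
rewrite inE => /andP[/injectiveP hi' /eqP hY'].
have pre x : exists y, h0 y == h x.
  have : inl (h x) \in im h0 (full e) by rewrite hY -hY' im_v ?full_v.
  by move=> /im_vP[y -> _]; exists y.
pose a : {ffun V -> V} := [ffun x => xchoose (pre x)].
have aP x : h0 (a x) = h x by rewrite ffunE; apply/eqP/(xchooseP (pre x)).
have ai : injective a by move=> x y axy; apply: hi'; rewrite -!aP axy.
have ha : h = c a by apply/ffunP => x; rewrite ffunE aP.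
exists a => //; rewrite inE is_isoE inE; apply/andP; split; first exact/injectiveP.
by apply/eqP/(im_inj hi); rewrite -cE // -ha hY' hY.
Qed.

Lemma aut_order_iso (V W : finType) (e : simple_graph V) (f : simple_graph W) :
  isomorphic e f -> aut_order e = aut_order f.
Proof.
suff le V' W' (e' : simple_graph V') (f' : simple_graph W') :
    isomorphic e' f' -> (aut_order e' <= aut_order f')%N.
  by move=> ef; apply/eqP; rewrite eqn_leq !le // iso_sym.
move=> /isoP[h [g hK gK] he]; pose c (a : {ffun V' -> V'}) := [ffun y => h (a (g y))].
have c_inj : injective c.
  move=> a b /ffunP ab; apply/ffunP => x; have := ab (h x).
  by rewrite !ffunE hK => /(can_inj hK).
rewrite /aut_order -(card_image c_inj); apply: subset_leq_card.
apply/subsetP => _ /imageP[a + ->].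
rewrite !inE => /andP[/andP[/injectiveP ai /forallP ae] /forallP asurj].
apply/andP; split; [apply/andP; split|].
- by apply/injectiveP => x y; rewrite !ffunE => /(can_inj hK)/ai/(can_inj gK).
- apply/forallP => x; apply/forallP => y; rewrite !ffunE -he.
  by have /forallP/(_ (g y))/eqP<- := ae (g x); rewrite he !gK.
apply/forallP => y; have /existsP[x /eqP xE] := asurj (g y).
by apply/existsP; exists (h x); rewrite ffunE hK xE gK.
Qed.

Lemma card_embeddings_class (V : finType) (Y : {set cell V}) s : wf Y ->
  #|embeddings (rep s) Y| = if cl Y == s then Aut_card s else 0%N.
Proof.
move=> wY; case: eqP => [ys|nys].
  have [h hi hY] : exists2 h : 'I_(nverts s) -> V, injective h & im h (full (rep s)) = Y.
    by apply: cl_eqP; rewrite // rep_iclass.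
  apply: (card_embeddings (h0 := [ffun x => h x])); rewrite inE; apply/andP; split.
    by apply/injectiveP => x y; rewrite !ffunE => /hi.
  by rewrite -hY; apply/eqP/eq_im => x; rewrite ffunE.
apply: eq_card0 => h; rewrite inE; apply/negbTE/negP => /andP[/injectiveP hi /eqP hY].
by apply: nys; rewrite -hY cl_im // cl_full rep_iclass.
Qed.

Lemma Aut_card_gt0 s : (0 < Aut_card s)%N.
Proof.
apply/card_gt0P; exists [ffun x => x]; rewrite inE is_isoE inE; apply/andP; split.
  by apply/injectiveP => x y; rewrite !ffunE.
apply/eqP; rewrite -[RHS]imset_id; apply: eq_imset => -[x|[x y]] /=; by rewrite !ffunE.
Qed.

Section Count.
Variable P : rule.

(* The common form of [Mcount] and [Rcount]. *)
Definition splits_count (s t g : isoclass) : nat :=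
  #|[pred f : {ffun 'I_(nverts s) + 'I_(nverts t) -> 'I_(nverts g)} |
      [&& injectiveb (fun x => f (inl x)), injectiveb (fun x => f (inr x))
        & splits P (full (rep g)) (im (fun x => f (inl x)) (full (rep s)))
            (im (fun x => f (inr x)) (full (rep t)))]]|.

Definition splits_number (s t g : isoclass) : nat :=
  #|[pred p : {set cell 'I_(nverts g)} * {set cell 'I_(nverts g)} |
      splits P (full (rep g)) p.1 p.2 && ((cl p.1, cl p.2) == (s, t))]|.

Lemma delta_coeff s t g : (delta P << g >>)@_(s, t) = (splits_number s t g)%:R.
Proof.
rewrite deltaU /split_sum raddf_sum /=.
under eq_bigr do rewrite mcoeffU mulrb.
by rewrite -big_mkcondr sumr_const.
Qed.

Lemma splits_countE s t g :
  splits_count s t g = (splits_number s t g * (Aut_card s * Aut_card t))%N.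
Proof.
set X := full (rep g); have wX : wf X := wf_full _.
pose S := {ffun 'I_(nverts s) -> 'I_(nverts g)}; pose T := {ffun 'I_(nverts t) -> 'I_(nverts g)}.
pose glue (q : S * T) : {ffun 'I_(nverts s) + 'I_(nverts t) -> 'I_(nverts g)} :=
  [ffun c => match c with inl x => q.1 x | inr y => q.2 y end].
rewrite /splits_count -sum1_card (reindex glue) /=; last first.
  exists (fun f => ([ffun x => f (inl x)], [ffun x => f (inr x)])) => [[f1 f2] _|f _].
    by congr pair; apply/ffunP => x; rewrite !ffunE.
  by apply/ffunP => -[x|x]; rewrite !ffunE.
(* Sort the maps by their pair of images; the fibre over [(Y, Z)] is the product of the embeddings
   onto [Y] and those onto [Z]. *)
rewrite (partition_big (fun q : S * T => (im q.1 (full (rep s)), im q.2 (full (rep t))))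
  (fun p => splits P X p.1 p.2)) /=; last first.
  move=> [f1 f2]; rewrite inE => /and3P[_ _] /=.
  rewrite (eq_im (g := f1)); last by move=> x; rewrite ffunE.
  by rewrite (eq_im (g := f2) (full (rep t))) => [|x] //; rewrite ffunE.
rewrite /splits_number -sum1_card big_distrl /= big_mkcondr /=.
apply: eq_bigr => -[Y Z] /= PYZ; have [wY wZ _ _] := splits_sub wX PYZ.
transitivity (#|embeddings (rep s) Y| * #|embeddings (rep t) Z|)%N; last first.
  rewrite !card_embeddings_class // xpair_eqE.
  by case: (cl Y == s); case: (cl Z == t); rewrite ?mul1n ?mul0n ?muln0.
rewrite -cardX -sum1_card; apply: eq_bigl => -[f1 f2]; rewrite !inE /=.
rewrite (eq_im (g := f1)); last by move=> x; rewrite ffunE.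
rewrite (eq_im (g := f2) (full (rep t))); last by move=> x; rewrite ffunE.
have -> : injectiveb (fun x => glue (f1, f2) (inl x)) = injectiveb f1.
  by apply/injectiveP/injectiveP => + x y => /(_ x y); rewrite !ffunE.
have -> : injectiveb (fun x => glue (f1, f2) (inr x)) = injectiveb f2.
  by apply/injectiveP/injectiveP => + x y => /(_ x y); rewrite !ffunE.
rewrite xpair_eqE; case: eqP => [->|_]; case: eqP => [->|_]; rewrite ?andbF //= PYZ.
by rewrite !andbT.
Qed.

End Count.

(** That both halves are homomorphisms says that the two images lie in the target; surjectivity on
    vertices and edges says that they exhaust it. *)
Lemma Mcount_splits s t g : Mcount s t g = splits_count mono_rule s t g.
Proof.
apply: eq_card => f; rewrite !inE /= /is_mono /splits_mono.
set f1 := (fun x => f (inl x)); set f2 := (fun x => f (inr x)).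
have [i1|] := injectiveP f1; last by rewrite !andbF.
have [i2|] := injectiveP f2; last by rewrite !andbF.
rewrite !andbT !wf_im // !wf_full /=.
have fE c : f c = match c with inl x => f1 x | inr y => f2 y end by case: c.
apply/and3P/eqP => [[/and3P[_ /forallP sv /forallP se] /forallP h1 /forallP h2]|E].
  apply/setP => -[w|[w w']]; rewrite [RHS]inE.
    rewrite full_v; have /existsP[[v|v] /eqP<-] := sv w; rewrite fE ?im_v ?full_v ?orbT //.
  rewrite full_e; apply/idP/orP => [ww|].
    have /forallP/(_ w')/implyP/(_ ww)/existsP[[v|v] /existsP[[v'|v'] /and3P[//= vv]]] := se w.
      by rewrite !fE => /eqP<- /eqP<-; left; rewrite im_e ?full_e.
    by rewrite !fE => /eqP<- /eqP<-; right; rewrite im_e ?full_e.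
  case=> /im_eP[x [y [-> -> ]]]; rewrite full_e => xy.
    by have /forallP/(_ y)/implyP/(_ xy) := h1 x.
  by have /forallP/(_ y)/implyP/(_ xy) := h2 x.
have h1 x y : rep s x y -> rep g (f1 x) (f1 y).
  by rewrite -!full_e E finset.in_setU im_e // => ->.
have h2 x y : rep t x y -> rep g (f2 x) (f2 y).
  by rewrite -!full_e E finset.in_setU [X in _ || X]im_e // => ->; rewrite orbT.
split.
- apply/and3P; split.
  + by apply/forallP => -[x|x]; apply/forallP => -[y|y]; apply/implyP => //=; rewrite !fE;
      [apply: h1|apply: h2].
  + apply/forallP => w; apply/existsP; have := full_v (rep g) w; rewrite E inE.
    by move=> /orP[]/im_vP[x -> _]; [exists (inl x)|exists (inr x)]; rewrite fE.
  + apply/forallP => w; apply/forallP => w'; apply/implyP; rewrite -full_e E finset.in_setU.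
    move=> /orP[]/im_eP[x [y [-> -> ]]]; rewrite full_e => xy; apply/existsP.
      by exists (inl x); apply/existsP; exists (inl y); apply/and3P; split; rewrite ?fE.
    by exists (inr x); apply/existsP; exists (inr y); apply/and3P; split; rewrite ?fE.
- by apply/forallP => x; apply/forallP => y; apply/implyP/h1.
- by apply/forallP => x; apply/forallP => y; apply/implyP/h2.
Qed.

Lemma ind_full_im (V W : finType) (e : simple_graph V) (f : simple_graph W) (h : V -> W) :
  injective h -> (im h (full e) == ind (full f) (im h (full e))) =
  [forall x, forall y, e x y == f (h x) (h y)].
Proof.
move=> hi; apply/ind_eqP/forallP => [[_ E] x|he].
  apply/forallP => y; have := E (h x) (h y).
  by rewrite im_e // !im_v // !full_v !andbT !full_e => ->.
split=> [w _|w w']; first exact: full_v.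
apply/idP/and3P => [/im_eP[x [y [-> -> ]]]|[ww /im_vP[x wE _] /im_vP[y wE' _]]].
  by rewrite !im_v // !full_v !full_e; have /forallP/(_ y)/eqP<- := he x.
by rewrite wE wE' im_e // in ww *; move: ww; rewrite !full_e; have /forallP/(_ y)/eqP<- := he x.
Qed.

Lemma Rcount_splits s t g : Rcount s t g = splits_count regmono_rule s t g.
Proof.
apply: eq_card => f; rewrite !inE /= /is_regmono /splits_regmono /is_epi.
set f1 := (fun x => f (inl x)); set f2 := (fun x => f (inr x)).
have [i1|] := injectiveP f1; last by rewrite !andbF.
have [i2|] := injectiveP f2; last by rewrite !andbF.
rewrite !ind_full_im //=.
have fE c : f c = match c with inl x => f1 x | inr y => f2 y end by case: c.
rewrite andbC -!andbA.
case: (boolP [forall x, _]) => //= /forallP h1; case: (boolP [forall x, _]) => //= /forallP h2.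
(* No edge joins the two halves, so two regular monomorphisms always glue to a homomorphism, and
   surjectivity on vertices is all that remains of [is_epi]. *)
have -> /= : is_hom (dunion (rep s) (rep t)) (rep g) f.
  apply/forallP => -[x|x]; apply/forallP => -[y|y]; apply/implyP => //=; rewrite !fE.
    by have /forallP/(_ y)/eqP-> := h1 x.
  by have /forallP/(_ y)/eqP-> := h2 x.
apply/forallP/forallP => cov w.
  apply/implyP => _; have /existsP[[v|v] /eqP<-] := cov w; rewrite fE ?im_v ?full_v ?orbT //.
apply/existsP; have /implyP/(_ (full_v _ _))/orP[/im_vP[x -> _]|/im_vP[x -> _]] := cov w.
  by exists (inl x); rewrite fE.
by exists (inr x); rewrite fE.
Qed.

(** Disjointness of the images makes the glued map injective, so the maps counted are the
    isomorphisms from the disjoint union onto [g]. *)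
Lemma hom_count s t g :
  splits_count hom_rule s t g = if g == union s t then Aut_card g else 0%N.
Proof.
transitivity #|embeddings (dunion (rep s) (rep t)) (full (rep g))|.
  apply: eq_card => f; rewrite !inE /= /splits_hom /splits_mono full_dunion.
  set f1 := (fun x => f (inl x)); set f2 := (fun x => f (inr x)).
  have fE c : f c = match c with inl x => f1 x | inr y => f2 y end by case: c.
  have [i1|n1] := injectiveP f1; last first.
    by apply/esym/negbTE; apply: contra_notN n1 => /andP[/injectiveP fi _] x y /fi[].
  have [i2|n2] := injectiveP f2; last first.
    by apply/esym/negbTE; apply: contra_notN n2 => /andP[/injectiveP fi _] x y /fi[].
  rewrite !wf_im // !wf_full /=.
  have imU : im f (dcells (full (rep s)) (full (rep t))) =
      im f1 (full (rep s)) :|: im f2 (full (rep t)).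
    apply/setP => c; rewrite inE; apply/imsetP/orP => [[[[x|x]|[[x|x] [y|y]]]]|].
    + by rewrite inE => xX ->; left; apply/imsetP; exists (inl x).
    + by rewrite inE => xX ->; right; apply/imsetP; exists (inl x).
    + by rewrite inE => xX ->; left; apply/imsetP; exists (inr (x, y)).
    + by rewrite inE.
    + by rewrite inE.
    + by rewrite inE => xX ->; right; apply/imsetP; exists (inr (x, y)).
    case=> /imsetP[[x|[x y]]] xX ->.
    + by exists (inl (inl x)); rewrite ?inE.
    + by exists (inr (inl x, inl y)); rewrite // inE.
    + by exists (inl (inr x)); rewrite ?inE.
    + by exists (inr (inr x, inr y)); rewrite // inE.
  rewrite imU [in RHS]eq_sym andbC; congr andb.
  apply/eqP/injectiveP => [d0 [x|x] [y|y]|fi]; rewrite ?fE.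
  - by move=> /i1->.
  - move=> xy; have : inl (f1 x) \in im f1 (full (rep s)) :&: im f2 (full (rep t)).
      by rewrite inE im_v // full_v xy [X in _ && X]im_v // full_v.
    by rewrite d0 inE.
  - move=> xy; have : inl (f1 y) \in im f1 (full (rep s)) :&: im f2 (full (rep t)).
      by rewrite inE im_v // full_v -xy [X in _ && X]im_v // full_v.
    by rewrite d0 inE.
  - by move=> /i2->.
  apply/setP => c; rewrite !inE; apply/negbTE/negP => /andP[].
  by move=> /imsetP[[x|[x x']] _ ->] /imsetP[[y|[y y']] _] //= [] => [/fi|/fi].
case: eqP => [gst|ng].
  have : isomorphic (dunion (rep s) (rep t)) (rep g) by apply/iclassP; rewrite rep_iclass.
  move=> giso; have /existsP[h] := giso; rewrite is_isoE => /card_embeddings ->.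
  exact: aut_order_iso.
apply: eq_card0 => h; apply/negbTE/negP => hE; apply: ng.
rewrite -(rep_iclass g); apply/esym/iclassP/existsP; exists h; by rewrite is_isoE.
Qed.

(** * Adjoints and rescaling *)

Section Tensors.
Variables (K L : choiceType).
Implicit Types (x : free K) (y : free L).

Lemma linear_sumE (W : lmodType rat) (f : free K -> W) x :
  linear f -> f x = \sum_(k <- msupp x) x@_k *: f << k >>.
Proof.
move=> lf; rewrite -[RHS]/(lin_ext (fun k => f << k >>) x).
by move: x; apply: linear_ext => // [|k]; [apply: lin_ext_linear|rewrite lin_extU].
Qed.

Lemma tens_linearr x : linear (tens x : free L -> free (K * L)%type).
Proof. exact: bilin_ext_linearr. Qed.

Lemma tens_linearl y : linear ((fun x => tens x y) : free K -> free (K * L)%type).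
Proof. exact: bilin_ext_linearl. Qed.

Lemma lin_ext_tens (W : lmodType rat) (B : free K -> free L -> W) :
  (forall y, linear (B^~ y)) -> (forall x, linear (B x)) ->
  forall x y, lin_ext (fun p => B << p.1 >> << p.2 >>) (tens x y) = B x y.
Proof.
move=> Bl Br; apply: bilin_basis_ext => // [y|x|k l].
- exact: linear_comp (tens_linearl _) (lin_ext_linear _).
- exact: linear_comp (tens_linearr _) (lin_ext_linear _).
by rewrite tensU lin_extU.
Qed.

Lemma tens_coeff x y p : (tens x y)@_p = x@_p.1 * y@_p.2.
Proof.
case: p => a b; move: x y.
apply: (bilin_basis_ext (W := rat^o) (f := fun x y => (tens x y)@_(a, b))
  (g := fun x y => x@_a * y@_b)) => [y|x|y|x|k l] => [c z z'|c z z'|c z z'|c z z'|].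
- by rewrite /tens bilin_ext_linearl mcoeffD mcoeffZ.
- by rewrite /tens bilin_ext_linearr mcoeffD mcoeffZ.
- by rewrite mcoeffD mcoeffZ mulrDl -mulrA.
- by rewrite mcoeffD mcoeffZ mulrDr mulrCA.
by rewrite tensU !mcoeffU xpair_eqE; case: (k == a); case: (l == b);
  rewrite ?mulr1 ?mulr0.
Qed.

Lemma linear_scale (U W : lmodType rat) (f : U -> W) : linear f -> 
  forall c u, f (c *: u) = c *: f u.
Proof.
move=> lf c u; pose F : {linear U -> W} := HB.pack f (GRing.isLinear.Build _ _ _ _ _ lf).
exact: (linearZ_LR F).
Qed.

Lemma linear_add (U W : lmodType rat) (f : U -> W) : linear f -> {morph f : u v / u + v}.
Proof.
move=> lf u v; pose F : {linear U -> W} := HB.pack f (GRing.isLinear.Build _ _ _ _ _ lf).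
exact: (raddfD F).
Qed.

Lemma pairingU k x : pairing << k >> x = x@_k.
Proof. by rewrite /pairing msuppU oner_eq0 big_seq_fset1 mcoeffUU mul1r. Qed.

End Tensors.

Section Adjoints.
Variables (K L : choiceType).

(** Transposed matrices for the orthonormal bases, compared entry by entry; linearity is asked for
    separately where it is needed. *)
Definition adjoint (f : free K -> free L) (g : free L -> free K) : Prop :=
  forall k l, (f << k >>)@_l = (g << l >>)@_k.

(** A linear map is determined by its adjoint, so an identity between linear maps can be checked on
    the transposed side. *)
Lemma adjoint_ext (f f' : free K -> free L) (g g' : free L -> free K) :
  linear f -> linear f' -> adjoint f g -> adjoint f' g' ->
  (forall y, g y = g' y) -> forall x, f x = f' x.
Proof.
move=> lf lf' fg fg' gg'; apply: linear_ext => // k; apply/malgP => l.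
by rewrite fg fg' gg'.
Qed.

End Adjoints.

Lemma adjointC (K L : choiceType) (f : free K -> free L) (g : free L -> free K) :
  adjoint f g -> adjoint g f.
Proof. by move=> fg l k; rewrite fg. Qed.

Lemma adjoint_id (K : choiceType) : adjoint (@id (free K)) id.
Proof. by move=> k l; rewrite !mcoeffU eq_sym. Qed.

Lemma adjoint_comp (K L M : choiceType) (f : free K -> free L) (g : free L -> free K)
    (f' : free L -> free M) (g' : free M -> free L) :
  linear f' -> linear g -> adjoint f g -> adjoint f' g' ->
  adjoint (fun x => f' (f x)) (fun z => g (g' z)).
Proof.
move=> lf' lg fg fg' k m.
rewrite (linear_sumE _ lf') (linear_sumE _ lg) !raddf_sum /=.
set x := f << k >>; set z := g' << m >>.
(* Each side is a matrix product summed over its own support; both are extended to this common index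
   set, where the added terms vanish. *)
pose d := (msupp x `|` msupp z)%fset.
rewrite (big_fset_incl _ (fsubsetUl (msupp x) (msupp z))) /=; last first.
  by move=> l _ lx; rewrite (mcoeff_outdom lx) scale0r mcoeff0.
rewrite [RHS](big_fset_incl _ (fsubsetUr (msupp x) (msupp z))) /=; last first.
  by move=> l _ lx; rewrite (mcoeff_outdom lx) scale0r mcoeff0.
by apply: eq_bigr => l _; rewrite !mcoeffZ fg' -fg mulrC.
Qed.

Lemma adjoint_tens (K L K' L' : choiceType) (f : free K -> free L) (g : free L -> free K)
    (f' : free K' -> free L') (g' : free L' -> free K') :
  adjoint f g -> adjoint f' g' -> adjoint (tens_map f f') (tens_map g g').
Proof. by move=> fg fg' [k k'] [l l']; rewrite !tens_mapU !tens_coeff /= fg fg'. Qed.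

(** * The bialgebra axioms as identities between linear maps, and their transposes *)

Definition tens_unassoc (K : choiceType) :
    free (K * (K * K))%type -> free (K * K * K)%type :=
  lin_ext (fun p => << (p.1, p.2.1, p.2.2) >>).

(** The exchange of the two middle factors. By [tens_mulE] it makes the product of the tensor square
    a composite of linear maps, and it is its own adjoint. *)
Definition tens_twist (K : choiceType) :
    free (K * K * (K * K))%type -> free (K * K * (K * K))%type :=
  lin_ext (fun p => << ((p.1.1, p.2.1), (p.1.2, p.2.2)) >>).

(** The linear map on the tensor square through which a bilinear product factors; it is this map
    that has an adjoint. *)
Definition product_map (K : choiceType) (mul : free K -> free K -> free K) :
    free (K * K)%type -> free K :=
  lin_ext (fun p => mul << p.1 >> << p.2 >>).

Section Coalgebra.
Variable K : choiceType.
Implicit Types (mul : free K -> free K -> free K) (D : free K -> free (K * K)%type).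

Lemma tens_unassoc_linear : linear (@tens_unassoc K).
Proof. exact: lin_ext_linear. Qed.

Lemma tens_twist_linear : linear (@tens_twist K).
Proof. exact: lin_ext_linear. Qed.

Lemma product_map_linear mul : linear (product_map mul).
Proof. exact: lin_ext_linear. Qed.

Lemma tens_assocK : cancel (@tens_assoc K) (@tens_unassoc K).
Proof.
apply: linear_ext => [||[[a b] c]] //.
  exact: linear_comp (@tens_assoc_linear _) tens_unassoc_linear.
by rewrite /tens_assoc /tens_unassoc !lin_extU.
Qed.

Lemma tens_unassocK : cancel (@tens_unassoc K) (@tens_assoc K).
Proof.
apply: linear_ext => [||[a [b c]]] //.
  exact: linear_comp tens_unassoc_linear (@tens_assoc_linear _).
by rewrite /tens_assoc /tens_unassoc !lin_extU.
Qed.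

Lemma adjoint_assoc : adjoint (@tens_assoc K) (@tens_unassoc K).
Proof.
move=> [[a b] c] [a' [b' c']]; rewrite /tens_assoc /tens_unassoc !lin_extU !mcoeffU /=.
by rewrite eq_sym !xpair_eqE andbA.
Qed.

Lemma adjoint_twist : adjoint (@tens_twist K) (@tens_twist K).
Proof.
move=> [[a b] [c d]] [[a' b'] [c' d']]; rewrite /tens_twist !lin_extU !mcoeffU /=.
by rewrite eq_sym !xpair_eqE andbACA.
Qed.

Lemma tens_assoc_coeff x p : (@tens_assoc K x)@_p = x@_(p.1, p.2.1, p.2.2).
Proof.
move: x; apply: (linear_ext (W := rat^o)) => [c z z'|c z z'|k].
- by rewrite tens_assoc_linear mcoeffD mcoeffZ.
- by rewrite mcoeffD mcoeffZ.
by rewrite adjoint_assoc [X in X@_k]lin_extU !mcoeffU eq_sym.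
Qed.

Lemma product_mapE mul : (forall y, linear (mul^~ y)) -> (forall x, linear (mul x)) ->
  forall x y, mul x y = product_map mul (tens x y).
Proof. by move=> ml mr x y; rewrite /product_map lin_ext_tens. Qed.

Lemma tens_map_tens (K1 L1 K2 L2 : choiceType) (f : free K1 -> free K2)
    (g : free L1 -> free L2) : linear f -> linear g ->
  forall x y, tens_map f g (tens x y) = tens (f x) (g y).
Proof.
move=> lf lg; apply: bilin_basis_ext => [y|x|y|x|k l].
- by apply: linear_comp (tens_map_linear _ _); apply: bilin_ext_linearl.
- by apply: linear_comp (tens_map_linear _ _); apply: bilin_ext_linearr.
- by apply: linear_comp lf _; apply: bilin_ext_linearl.
- by apply: linear_comp lg _; apply: bilin_ext_linearr.
by rewrite tensU tens_mapU.
Qed.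

Lemma tens_mulE mul x y : tens_mul mul x y =
  tens_map (product_map mul) (product_map mul) (tens_twist (tens x y)).
Proof.
move: x y; apply: bilin_basis_ext => [y|x|y|x|[a b] [c d]].
- exact: bilin_ext_linearl.
- exact: bilin_ext_linearr.
- apply: linear_comp (tens_map_linear _ _); apply: linear_comp tens_twist_linear.
  exact: bilin_ext_linearl.
- apply: linear_comp (tens_map_linear _ _); apply: linear_comp tens_twist_linear.
  exact: bilin_ext_linearr.
rewrite [LHS]bilin_extU tensU /tens_twist lin_extU tens_mapU /product_map !lin_extU.
by [].
Qed.

Lemma tens_mulU mul a b c d : tens_mul mul << (a, b) >> << (c, d) >> =
  tens (mul << a >> << c >>) (mul << b >> << d >>).
Proof. exact: bilin_extU. Qed.

Lemma tens_mul_bilinl mul w : linear ((@tens_mul K mul)^~ w).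
Proof. exact: bilin_ext_linearl. Qed.

Lemma tens_mul_bilinr mul z : linear (@tens_mul K mul z).
Proof. exact: bilin_ext_linearr. Qed.

Lemma tens_twist_coeff x p :
  (@tens_twist K x)@_p = x@_((p.1.1, p.2.1), (p.1.2, p.2.2)).
Proof.
move: x; apply: (linear_ext (W := rat^o)) => [c z z'|c z z'|k].
- by rewrite tens_twist_linear mcoeffD mcoeffZ.
- by rewrite mcoeffD mcoeffZ.
by rewrite adjoint_twist [X in X@_k]lin_extU !mcoeffU eq_sym.
Qed.

Lemma tens_mul_tens mul : (forall y, linear (mul^~ y)) -> (forall x, linear (mul x)) ->
  forall x y z w, tens_mul mul (tens x y) (tens z w) = tens (mul x z) (mul y w).
Proof.
move=> ml mr x y z w; rewrite tens_mulE.
have -> : tens_twist (tens (tens x y) (tens z w)) = tens (tens x z) (tens y w).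
  apply/malgP => p; rewrite tens_twist_coeff (tens_coeff _ _ (p.1.1, p.2.1, (p.1.2, p.2.2))).
  by rewrite [RHS]tens_coeff /= !tens_coeff mulrACA.
have lp : linear (product_map mul) := product_map_linear mul.
by rewrite (tens_map_tens lp lp) !(product_mapE ml mr).
Qed.

Variable e : K.
Definition unit_at (c : rat) : free K := c *: << e >>.
Definition counit_at (x : free K) : rat := x@_e.
Definition counit_l : free (K * K)%type -> free K :=
  lin_ext (fun p => counit_at << p.1 >> *: << p.2 >>).
Definition counit_r : free (K * K)%type -> free K :=
  lin_ext (fun p => counit_at << p.2 >> *: << p.1 >>).

Lemma adjoint_counit_l : adjoint counit_l (tens << e >>).
Proof.
move=> [a b] k; rewrite /counit_l lin_extU /= /counit_at mcoeffZ tens_coeff /=.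
by rewrite !mcoeffU [a == e]eq_sym [b == k]eq_sym.
Qed.

Lemma adjoint_counit_r : adjoint counit_r (fun x => tens x << e >>).
Proof.
move=> [a b] k; rewrite /counit_r lin_extU /= /counit_at mcoeffZ tens_coeff /=.
by rewrite !mcoeffU [b == e]eq_sym [a == k]eq_sym mulrC.
Qed.

Lemma counit_l_linear : linear counit_l. Proof. exact: lin_ext_linear. Qed.
Lemma counit_r_linear : linear counit_r. Proof. exact: lin_ext_linear. Qed.

Lemma id_linear (W : lmodType rat) : linear (@id W). Proof. by []. Qed.

(* The bialgebra axioms are self-dual: taking adjoints of the identities between linear
   maps that express them exchanges product and coproduct. *)
Lemma dual_bialgebra mul D mul' D' :
  bialgebra mul unit_at D counit_at ->
  (forall y, linear (mul'^~ y)) -> (forall x, linear (mul' x)) -> linear D' ->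
  adjoint (product_map mul) D' -> adjoint (product_map mul') D ->
  bialgebra mul' unit_at D' counit_at.
Proof.
move=> B ml' mr' lD' mD' m'D.
have [ml mr lu lD lc massoc mul1 mur1 coassoc cl cr comul counit1 cmul c1] := B.
set m := product_map mul in mD' *; set m' := product_map mul' in m'D *.
have lm : linear m := product_map_linear _; have lm' : linear m' := product_map_linear _.
have mE x y : mul x y = m (tens x y) by apply: product_mapE.
have mE' x y : mul' x y = m' (tens x y) by apply: product_mapE.
have uE : unit_at 1 = << e >> by rewrite /unit_at scale1r.
have tmE x y : tens_mul mul x y = tens_map m m (tens_twist (tens x y)).
  exact: tens_mulE.
have tmE' x y : tens_mul mul' x y = tens_map m' m' (tens_twist (tens x y)).
  exact: tens_mulE.
clearbody m m'.
(* Associativity and multiplicativity of the coproduct are rewritten as identities on tensor powers,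
   the form in which they can be transposed. *)
have massoc_map x : m (tens_map m id x) = m (tens_map id m (tens_assoc x)).
  move: x; apply: linear_ext => [||[[a b] c]].
  - exact: linear_comp (tens_map_linear _ _) lm.
  - exact: linear_comp (@tens_assoc_linear _) (linear_comp (tens_map_linear _ _) lm).
  have mU k l : m << (k, l) >> = mul << k >> << l >> by rewrite mE tensU.
  rewrite tens_mapU /tens_assoc lin_extU tens_mapU !mU.
  exact: etrans (esym (mE _ _)) (etrans (esym (massoc _ _ _)) (mE _ _)).
have comul_map x : D (m x) = tens_map m m (tens_twist (tens_map D D x)).
  move: x; apply: linear_ext => [||[a b]].
  - exact: linear_comp lm lD.
  - exact: linear_comp (tens_map_linear _ _) (linear_comp tens_twist_linear (tens_map_linear _ _)).
  by rewrite tens_mapU -tensU -mE comul tmE.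
have D'D : adjoint D m' by apply: adjointC.
have Dm : adjoint D' m by apply: adjointC.
split; [exact: ml'|exact: mr'|exact: lu|exact: lD'|exact: lc| | | | | | | | | |exact: c1].
- have assoc' x : m' (tens_map m' id (tens_unassoc x)) = m' (tens_map id m' x).
    move: x; apply: (@adjoint_ext _ _ _ _
      (fun x => tens_assoc (tens_map D id (D x))) (fun x => tens_map id D (D x))) => //.
    + exact: linear_comp tens_unassoc_linear (linear_comp (tens_map_linear _ _) lm').
    + exact: linear_comp (tens_map_linear _ _) lm'.
    + apply: (adjoint_comp (f := @tens_unassoc K) (g := @tens_assoc K)
        (f' := fun x => m' (tens_map m' id x)) (g' := fun x => tens_map D id (D x))).
      * exact: linear_comp (tens_map_linear _ _) lm'.
      * exact: tens_assoc_linear.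
      * exact/adjointC/adjoint_assoc.
      apply: (adjoint_comp (f := tens_map m' id) (g := tens_map D id)) => //.
        exact: tens_map_linear.
      exact: adjoint_tens (@adjoint_id _).
    apply: (adjoint_comp (f := tens_map id m') (g := tens_map id D)) => //.
      exact: tens_map_linear.
    exact: adjoint_tens (@adjoint_id _) _.
  move=> x y z; rewrite !mE' -/m' .
  have -> : tens x (m' (tens y z)) = tens_map id m' (tens x (tens y z)).
    exact: esym (tens_map_tens (@id_linear _) lm' _ _).
  rewrite -assoc'; congr (m' _).
  have -> : tens_unassoc (tens x (tens y z)) = tens (tens x y) z.
    apply: (can_inj tens_assocK); rewrite tens_unassocK.
    apply/malgP => -[a [b c]]; rewrite !tens_assoc_coeff !tens_coeff /= ?tens_coeff.
    by rewrite mulrA.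
  exact: tens_map_tens lm' (@id_linear _) _ _.
- move=> x; rewrite uE mE'; move: x.
  apply: (@adjoint_ext _ _ _ id (fun x => counit_l (D x)) id) => //.
  + exact: linear_comp (tens_linearr _) lm'.
  + apply: (adjoint_comp (f := tens << e >>) (g := counit_l)) => //.
      exact: counit_l_linear.
    exact/adjointC/adjoint_counit_l.
  exact: adjoint_id.
- move=> x; rewrite uE mE'; move: x.
  apply: (@adjoint_ext _ _ _ id (fun x => counit_r (D x)) id) => //.
  + exact: linear_comp (tens_linearl _) lm'.
  + apply: (adjoint_comp (f := fun x => tens x << e >>) (g := counit_r)) => //.
      exact: counit_r_linear.
    exact/adjointC/adjoint_counit_r.
  exact: adjoint_id.
- move=> x; apply: (can_inj tens_unassocK); rewrite tens_assocK; move: x.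
  apply: (@adjoint_ext _ _ _ _ (fun x => m (tens_map m id x))
     (fun x => m (tens_map id m (tens_assoc x)))) => //.
  + exact: linear_comp lD' (tens_map_linear _ _).
  + exact: linear_comp lD' (linear_comp (tens_map_linear _ _) tens_unassoc_linear).
  + apply: (adjoint_comp (f := D') (g := m)) => //; first exact: tens_map_linear.
    exact: adjoint_tens (@adjoint_id _).
  apply: (adjoint_comp (f := D') (f' := fun x => tens_unassoc (tens_map id D' x))
    (g := m) (g' := fun x => tens_map id m (tens_assoc x))) => //.
    exact: linear_comp (tens_map_linear _ _) tens_unassoc_linear.
  apply: (adjoint_comp (f := tens_map id D') (g := tens_map id m)).
  + exact: tens_unassoc_linear.
  + exact: tens_map_linear.
  + exact: adjoint_tens (@adjoint_id _) _.
  exact/adjointC/adjoint_assoc.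
- apply: (@adjoint_ext _ _ _ id (fun x => m (tens << e >> x)) id) => //.
  + exact: linear_comp lD' counit_l_linear.
  + apply: (adjoint_comp (f := D') (g := m)) => //; first exact: counit_l_linear.
    exact: adjoint_counit_l.
  + exact: adjoint_id.
  by move=> x; rewrite -mE -uE mul1.
- apply: (@adjoint_ext _ _ _ id (fun x => m (tens x << e >>)) id) => //.
  + exact: linear_comp lD' counit_r_linear.
  + apply: (adjoint_comp (f := D') (g := m)) => //; first exact: counit_r_linear.
    exact: adjoint_counit_r.
  + exact: adjoint_id.
  by move=> x; rewrite -mE -uE mur1.
(* This identity is the transpose of [comul_map], which has the same shape with product and
   coproduct exchanged. *)
- have comul' x : D' (m' x) = tens_map m' m' (tens_twist (tens_map D' D' x)).
    move: x; apply: (@adjoint_ext _ _ _ _ (fun x => D (m x))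
        (fun x => tens_map m m (tens_twist (tens_map D D x)))).
    + exact: linear_comp lm' lD'.
    + exact: linear_comp (tens_map_linear _ _)
        (linear_comp tens_twist_linear (tens_map_linear _ _)).
    + exact: adjoint_comp.
    + apply: (adjoint_comp (f := tens_map D' D') (g := tens_map m m)
      (f' := fun x => tens_map m' m' (tens_twist x)) (g' := fun x => tens_twist (tens_map D D x))).
      * exact: linear_comp tens_twist_linear (tens_map_linear _ _).
      * exact: tens_map_linear.
      * exact: adjoint_tens.
      apply: (adjoint_comp (f := @tens_twist K) (g := @tens_twist K)).
      * exact: tens_map_linear.
      * exact: tens_twist_linear.
      * exact: adjoint_twist.
      exact: adjoint_tens.
    exact: comul_map.
  by move=> x y; rewrite mE' comul' tens_map_tens // tmE'.
(* The coefficient of [D' << e >>] at [(a, b)] is the counit of the product of [a] and [b], so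
   multiplicativity of the old counit gives the new unit axiom. *)
- rewrite uE; apply/malgP => -[a b]; rewrite -mD' -tensU -mE.
  by rewrite -[LHS]/(counit_at _) cmul tens_coeff /counit_at !mcoeffU !(eq_sym e).
move=> x y; rewrite mE'.
rewrite -mE'; move: x y.
apply: (bilin_basis_ext (W := rat^o) (f := fun x y => counit_at (mul' x y))
  (g := fun x y => counit_at x * counit_at y)) => [y|x|y|x|k l]
  => [c z z'|c z z'|c z z'|c z z'|].
- by rewrite ml' /counit_at mcoeffD mcoeffZ.
- by rewrite mr' /counit_at mcoeffD mcoeffZ.
- by rewrite /counit_at mcoeffD mcoeffZ mulrDl -mulrA.
- by rewrite /counit_at mcoeffD mcoeffZ mulrDr mulrCA.
(* Conversely the counit of the new product is a coefficient of [D << e >>], known from the old unit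
   axiom. *)
by rewrite mE' tensU /counit_at m'D -uE counit1 tens_coeff uE /= !mcoeffU !(eq_sym e).
Qed.

End Coalgebra.

(** * Transport of a bialgebra along an invertible rescaling *)

Section Transport.
Variables (K : choiceType) (e : K).
Variables (mul mul' : free K -> free K -> free K) (D D' : free K -> free (K * K)%type).
Variables (phi psi : free K -> free K).
Hypotheses (lphi : linear phi) (psiK : cancel psi phi).
Hypotheses (phi_e : phi << e >> = << e >>) (eps_phi : forall x, (phi x)@_e = x@_e).
Hypotheses (phi_mul : forall x y, phi (mul x y) = mul' (phi x) (phi y)).
Hypotheses (phi_D : forall x, D' (phi x) = tens_map phi phi (D x)).

(** By [psiK] every element is [phi (psi x)], so each axiom on the target is the image under [phi]
    of the same axiom on the source. *)
Lemma transport_bialgebra :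
  (forall y, linear (mul'^~ y)) -> (forall x, linear (mul' x)) -> linear D' ->
  bialgebra mul (unit_at e) D (counit_at e) -> bialgebra mul' (unit_at e) D' (counit_at e).
Proof.
move=> ml' mr' lD' [ml mr lu lD lc massoc mul1 mur1 coassoc cl cr comul counit1 cmul c1].
have uE : unit_at e 1 = << e >> by rewrite /unit_at scale1r.
split; [exact: ml'|exact: mr'|exact: lu|exact: lD'|exact: lc| | | | | | | | | |exact: c1].
- move=> x y z; rewrite -(psiK x) -(psiK y) -(psiK z).
  by rewrite -[mul' (phi (psi y)) _]phi_mul -!phi_mul massoc.
- by move=> x; rewrite -(psiK x) uE -phi_e -phi_mul -uE mul1.
- by move=> x; rewrite -(psiK x) uE -phi_e -phi_mul -uE mur1.
- move=> x; rewrite -(psiK x) phi_D.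
  pose phi3 := tens_map phi (tens_map phi phi).
  have natl z : tens_assoc (tens_map D' id (tens_map phi phi z)) =
      phi3 (tens_assoc (tens_map D id z)).
    move: z; apply: linear_ext => [||[a b]].
    + exact: linear_comp (tens_map_linear _ _)
        (linear_comp (tens_map_linear _ _) (@tens_assoc_linear _)).
    + exact: linear_comp (tens_map_linear _ _)
        (linear_comp (@tens_assoc_linear _) (tens_map_linear _ _)).
    rewrite !tens_mapU (tens_map_tens lD' (@id_linear _)) phi_D.
    move: (D << a >>); apply: linear_ext => [||[c d]].
    + exact: linear_comp (tens_map_linear _ _)
        (linear_comp (tens_linearl _) (@tens_assoc_linear _)).
    + exact: linear_comp (tens_linearl _)
        (linear_comp (@tens_assoc_linear _) (tens_map_linear _ _)).
    rewrite tens_mapU !tensU [in RHS]/tens_assoc lin_extU /phi3 !tens_mapU /=.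
    by apply/malgP => p; rewrite tens_assoc_coeff !tens_coeff /= mulrA.
  have natr z : tens_map id D' (tens_map phi phi z) = phi3 (tens_map id D z).
    move: z; apply: linear_ext => [||[a b]].
    + exact: linear_comp (tens_map_linear _ _) (tens_map_linear _ _).
    + exact: linear_comp (tens_map_linear _ _) (tens_map_linear _ _).
    rewrite !tens_mapU (tens_map_tens (@id_linear _) lD') phi_D.
    by rewrite /phi3 (tens_map_tens lphi (tens_map_linear _ _)).
  by rewrite natl natr coassoc.
- move=> x; rewrite -[RHS]psiK -(cl (psi x)) -{1}(psiK x) phi_D.
  move: (D (psi x)); apply: linear_ext => [||[a b]].
  + exact: linear_comp (tens_map_linear _ _) (lin_ext_linear _).
  + exact: linear_comp (lin_ext_linear _) lphi.
  rewrite tens_mapU [in RHS]lin_extU /=.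
  rewrite (@lin_ext_tens _ _ _ (fun y z => counit_at e y *: z)) => [|y c z z'|y c z z'].
  + by rewrite /counit_at eps_phi (linear_scale lphi).
  + by rewrite /counit_at mcoeffD mcoeffZ scalerDl scalerA.
  + by rewrite scalerDr !scalerA mulrC.
- move=> x; rewrite -[RHS]psiK -(cr (psi x)) -{1}(psiK x) phi_D.
  move: (D (psi x)); apply: linear_ext => [||[a b]].
  + exact: linear_comp (tens_map_linear _ _) (lin_ext_linear _).
  + exact: linear_comp (lin_ext_linear _) lphi.
  rewrite tens_mapU [in RHS]lin_extU /=.
  rewrite (@lin_ext_tens _ _ _ (fun z y => counit_at e y *: z)) => [|y c z z'|y c z z'].
  + by rewrite /counit_at eps_phi (linear_scale lphi).
  + by rewrite scalerDr !scalerA mulrC.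
  + by rewrite /counit_at mcoeffD mcoeffZ scalerDl scalerA.
- move=> x y; rewrite -(psiK x) -(psiK y) -phi_mul !phi_D comul.
  move: (D (psi x)) (D (psi y)); apply: bilin_basis_ext => [z|z|z|z|[a b] [c d]].
  + exact: linear_comp (tens_mul_bilinl _ _) (tens_map_linear _ _).
  + exact: linear_comp (tens_mul_bilinr _ _) (tens_map_linear _ _).
  + exact: linear_comp (tens_map_linear _ _) (tens_mul_bilinl _ _).
  + exact: linear_comp (tens_map_linear _ _) (tens_mul_bilinr _ _).
  rewrite tens_mulU !tens_mapU (tens_mul_tens ml' mr') (tens_map_tens lphi lphi).
  rewrite !phi_mul; reflexivity.
- by rewrite uE -phi_e phi_D -uE counit1 uE (tens_map_tens lphi lphi) phi_e.
- move=> x y; rewrite -(psiK x) -(psiK y) -phi_mul.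
  by rewrite /counit_at !eps_phi; apply: cmul.
Qed.

End Transport.

(** * Antipodes *)

Section Antipode.
Variables (K : choiceType) (e : K) (nv : K -> nat).
Variables (mul : free K -> free K -> free K) (D : free K -> free (K * K)%type).
Hypothesis nv0 : forall k, nv k = 0%N -> k = e.
Hypothesis D_graded : forall k p, (D << k >>)@_p != 0 -> (nv p.1 + nv p.2)%N = nv k.
Hypothesis bialg : bialgebra mul (unit_at e) D (counit_at e).

(* Solves [S * id = unit o counit] degree by degree, from the term [S k * e] of the
   convolution; [n] is only fuel. *)
Fixpoint antipode_rec (n : nat) (k : K) : free K :=
  if n is n'.+1 then
    if k == e then << e >> else
    - \sum_(p <- msupp (D << k >>) | p.2 != e)
        (D << k >>)@_p *: mul (antipode_rec n' p.1) << p.2 >>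
  else 0.

(** The decrease that drives the recursion: only [e] can have degree zero, so any other second
    factor takes some degree away from the first. *)
Lemma nv_lt k p : p \in msupp (D << k >>) -> p.2 != e -> (nv p.1 < nv k)%N.
Proof.
rewrite -mcoeff_neq0 => /D_graded<- pe; rewrite -[X in (X < _)%N]addn0 ltn_add2l lt0n.
by apply: contra_neq pe => /nv0.
Qed.

Lemma antipode_rec_stable n m k : (nv k < n)%N -> (nv k < m)%N ->
  antipode_rec n k = antipode_rec m k.
Proof.
elim: n m k => // n IHn [//|m] k; rewrite !ltnS /= => kn km.
case: eqP => // _; congr (- _); rewrite big_seq_cond [RHS]big_seq_cond.
apply: eq_bigr => p /andP[pk pe]; have lt := nv_lt pk pe.
by rewrite (IHn m) // ?(leq_trans lt).
Qed.

Definition left_antipode : free K -> free K :=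
  lin_ext (fun k => antipode_rec (nv k).+1 k).

Lemma left_antipode_linear : linear left_antipode.
Proof. exact: lin_ext_linear. Qed.

Lemma left_antipode_e : left_antipode << e >> = << e >>.
Proof. by rewrite /left_antipode lin_extU /= eqxx. Qed.

Lemma left_antipodeE k : k != e -> left_antipode << k >> =
  - \sum_(p <- msupp (D << k >>) | p.2 != e)
      (D << k >>)@_p *: mul (left_antipode << p.1 >>) << p.2 >>.
Proof.
move=> /negbTE ke; rewrite {1}/left_antipode lin_extU /= ke; congr (- _).
rewrite big_seq_cond [RHS]big_seq_cond; apply: eq_bigr => p /andP[pk pe].
by rewrite /left_antipode lin_extU (@antipode_rec_stable (nv k) (nv p.1).+1) ?nv_lt.
Qed.

Lemma convolution_linear (S : free K -> free K) : linear (convolution mul D S id).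
Proof. exact: linear_comp (coproduct_linear bialg) (lin_ext_linear _). Qed.

(** Consequence of the counit axiom: the only term of the coproduct of [k] with second factor [e] is
    the one carrying the unknown value at [k], with coefficient 1. *)
Lemma coeff_right k l : (D << k >>)@_(l, e) = (k == l)%:R.
Proof.
have := counit_right bialg << k >>; rewrite -[lin_ext _ _]/(counit_r e (D << k >>)).
move=> /(congr1 (fun x => x@_l)); rewrite mcoeffU => <-.
move: (D _); apply: (linear_ext (W := rat^o)) => [c z z'|c z z'|[a b]].
- by rewrite mcoeffD mcoeffZ.
- by rewrite counit_r_linear mcoeffD mcoeffZ.
rewrite (adjoint_counit_r e (a, b) l) tens_coeff !mcoeffU xpair_eqE /=.
by rewrite [a == l]eq_sym [b == e]eq_sym; case: (l == a); case: (e == b).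
Qed.

Lemma left_antipodeP x : convolution mul D left_antipode id x = unit_at e (counit_at e x).
Proof.
have mr : right_id << e >> mul.
  by have := unit_right bialg; rewrite /unit_at scale1r.
move: x; apply: linear_ext => [|c x y|k].
- exact: convolution_linear.
- by rewrite /unit_at /counit_at mcoeffD mcoeffZ scalerDl scalerA.
rewrite /convolution /lin_ext (bigID (fun p => p.2 != e)) /=.
have inj2 : forall p : K * K, (~~ (p.2 != e)) = (p.2 == e) by move=> p; rewrite negbK.
under [X in _ + X]eq_bigl do rewrite inj2.
have -> : \sum_(p <- msupp (D << k >>) | p.2 == e)
     (D << k >>)@_p *: mul (left_antipode << p.1 >>) << p.2 >> = left_antipode << k >>.
  have ke : (k, e) \in msupp (D << k >>) by rewrite -mcoeff_neq0 coeff_right eqxx oner_eq0.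
  rewrite big_seq_cond (eq_bigl (fun p => (p \in msupp (D << k >>)) && (p == (k, e)))).
    rewrite -big_seq_cond -big_filter filter_pred1_uniq ?fset_uniq // big_seq1.
    rewrite coeff_right eqxx scale1r.
    exact: mr.
  move=> [a b] /=; case: (boolP ((a, b) \in _)) => //=; rewrite -mcoeff_neq0 xpair_eqE.
  case: (b =P e) => [->|]; last by rewrite andbF.
  by rewrite coeff_right andbT; case: (k =P a) => [->|]; rewrite eqxx.
have [->|nke] := eqVneq k e.
  rewrite left_antipode_e big1_seq; last first.
    move=> p /andP[pe pk]; have := nv_lt pk pe.
    (* The term at [(e, e)] gives [nv e + nv e = nv e], so [e] has degree zero and [nv_lt] leaves no
       further term. *)
    have /D_graded/eqP : (D << e >>)@_(e, e) != 0 by rewrite coeff_right eqxx oner_eq0.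
    by rewrite -[X in _ == X]addn0 eqn_add2l => /eqP->.
  by rewrite add0r /unit_at /counit_at mcoeffUU scale1r.
by rewrite (left_antipodeE nke) subrr /unit_at /counit_at mcoeffU (negbTE nke) scale0r.
Qed.

(** With a commutative product and a cocommutative coproduct, exchanging the tensor factors turns
    the left convolution inverse into a right one. *)
Lemma antipode_exists :
  (forall x y, mul x y = mul y x) ->
  (forall x, lin_ext (fun p => << (p.2, p.1) >>) (D x) = D x) ->
  exists S, antipode mul (unit_at e) D (counit_at e) S.
Proof.
move=> mulC DC; exists left_antipode; split; first exact: left_antipode_linear.
  exact: left_antipodeP.
move=> x; rewrite -[RHS]left_antipodeP /convolution -[in LHS]DC.
move: (D x); apply: linear_ext => [||[a b]].
- exact: linear_comp (lin_ext_linear _) (lin_ext_linear _).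
- exact: lin_ext_linear.
by rewrite !lin_extU /= mulC.
Qed.

End Antipode.

(** The left antipode equation at [pt] reads S(pt) + pt + S(pt) pt = 0. Applying [chi], with s its
    value at S(pt), gives s - 1 - s = 0. *)
Lemma no_antipode (K : choiceType) (e pt : K) mul D (chi : free K -> rat) :
  bialgebra mul (unit_at e) D (counit_at e) -> pt != e ->
  scalar chi -> (forall x y, chi (mul x y) = chi x * chi y) -> chi << pt >> = -1 ->
  D << pt >> = << (pt, e) >> + << (e, pt) >> + << (pt, pt) >> ->
  ~ exists S, antipode mul (unit_at e) D (counit_at e) S.
Proof.
move=> B pte lchi chiM chi_pt Dpt [S [lS left _]].
have uE : unit_at e 1 = << e >> by rewrite /unit_at scale1r.
have mr : right_id << e >> mul by have := unit_right B; rewrite uE.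
have ml : left_id << e >> mul by have := unit_left B; rewrite uE.
have De : D << e >> = << (e, e) >> by have := coproduct_unit B; rewrite uE tensU.
have Se : S << e >> = << e >>.
  have := left << e >>; rewrite /convolution De lin_extU /= mr => ->.
  by rewrite /unit_at /counit_at mcoeffUU scale1r.
have := left << pt >>; rewrite /convolution Dpt !(linear_add (lin_ext_linear _)) !lin_extU /=.
rewrite mr Se ml /unit_at /counit_at mcoeffU (negbTE pte) scale0r.
move=> /(congr1 chi); rewrite !(linear_add (W := rat^o) lchi) chiM chi_pt mulrN1.
have -> : chi 0 = 0 by rewrite -(scale0r (0 : free K)) (linear_scale (W := rat^o) lchi) scale0r.
by rewrite addrAC subrr add0r => /eqP; rewrite oppr_eq0 oner_eq0.
Qed.

(** * Structure constants *)

(** The sum over the whole basis takes its default value when infinitely many terms are nonzero;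
    here the terms vanish outside the support of [x]. *)
Lemma fsbig_coeff (K : choiceType) (c : K -> rat) (x : free K) :
  (forall k, x@_k = c k) -> \sum_(k \in [set: K]) c k *: << k >> = x.
Proof.
move=> xc; rewrite (fsbigTE (msupp x)) => [|k kx].
  apply: etrans (esym (linear_sumE x (@id_linear _))).
  by apply: eq_bigr => k _; rewrite -xc.
by rewrite -xc mcoeff_outdom // scale0r.
Qed.

Lemma coproduct_coeff (K L : choiceType) (c : K -> L -> rat) (D : free K -> free L) :
  linear D -> (forall k l, (D << k >>)@_l = c k l) ->
  lin_ext (fun k => \sum_(l \in [set: L]) c k l *: << l >>) = D.
Proof.
move=> lD Dc; apply/funext/linear_ext => // [|k]; first exact: lin_ext_linear.
by rewrite lin_extU; apply: fsbig_coeff => l; rewrite Dc.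
Qed.

(** A finite set that contains all classes with at most [n] vertices, since such a graph can be
    drawn inside ['I_n]. *)
Definition bounded (n : nat) : {fset isoclass} :=
  seq_fset tt [seq cl X | X : {set cell 'I_n}].

Lemma mem_bounded n s : (nverts s <= n)%N -> s \in bounded n.
Proof.
move=> sn; rewrite seq_fsetE; apply/imageP; exists (im (widen_ord sn) (full (rep s))) => //.
by rewrite cl_im ?cl_full ?rep_iclass // => x y /(congr1 val) /= xy; apply/val_inj.
Qed.

Definition locally_finite (D : QG -> QG2) : Prop :=
  forall g p, (D << g >>)@_p != 0 -> (nverts g <= nverts p.1 + nverts p.2)%N.

(** Only classes with at most [nverts s + nverts t] vertices contribute, so the defining sum can be
    taken over [bounded] and its coefficients read off. *)
Lemma dual_mul_coeff D s t g : locally_finite D ->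
  (dual_mul D << s >> << t >>)@_g = (D << g >>)@_(s, t).
Proof.
move=> finD; rewrite /dual_mul bilin_extU tensU.
pose B := bounded (nverts s + nverts t).
have out k : k \notin B -> (D << k >>)@_(s, t) = 0.
  by move=> kB; apply/eqP; apply: contraNT kB => /finD; apply: mem_bounded.
have -> : \sum_(k \in [set: isoclass]) pairing << (s, t) >> (D << k >>) *: << k >> =
    \sum_(k <- B) (D << k >>)@_(s, t) *: << k >> :> QG.
  rewrite (fsbigTE B) => [|k kB]; last by rewrite pairingU out ?scale0r.
  by apply: eq_bigr => k _; rewrite pairingU.
rewrite raddf_sum /=.
under eq_bigr do rewrite mcoeffZ mcoeffU.
have [gB|gB] := boolP (g \in B); last first.
  rewrite out // big1_seq // => k /andP[_ kB]; case: eqP => [kg|]; rewrite ?mulr0 //.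
  by rewrite -kg kB in gB.
rewrite (big_fsetD1 g gB) /= eqxx mulr1 big1_seq ?addr0 // => k /andP[_].
by rewrite in_fsetD1 => /andP[/negbTE->]; rewrite mulr0.
Qed.

Lemma dual_mul_linearl D y : linear ((dual_mul D)^~ y).
Proof. exact: bilin_ext_linearl. Qed.

Lemma dual_mul_linearr D x : linear (dual_mul D x).
Proof. exact: bilin_ext_linearr. Qed.

Lemma mul_hom_linearl y : linear (mul_hom^~ y).
Proof. exact: bilin_ext_linearl. Qed.

Lemma mul_hom_linearr x : linear (mul_hom x).
Proof. exact: bilin_ext_linearr. Qed.

Lemma product_dual_mul D : locally_finite D -> adjoint (product_map (dual_mul D)) D.
Proof. by move=> finD [s t] g; rewrite /product_map lin_extU dual_mul_coeff. Qed.

Lemma dual_mulC D : locally_finite D ->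
  (forall g s t, (D << g >>)@_(s, t) = (D << g >>)@_(t, s)) ->
  forall x y, dual_mul D x y = dual_mul D y x.
Proof.
move=> finD symD; apply: bilin_basis_ext => [y|x|y|x|s t].
- exact: dual_mul_linearl.
- exact: dual_mul_linearr.
- exact: dual_mul_linearr.
- exact: dual_mul_linearl.
by apply/malgP => g; rewrite !dual_mul_coeff // symD.
Qed.

Lemma cocomm_coeff (D : QG -> QG2) : linear D ->
  (forall g s t, (D << g >>)@_(s, t) = (D << g >>)@_(t, s)) ->
  forall x, lin_ext (fun p => << (p.2, p.1) >> : QG2) (D x) = D x.
Proof.
move=> lD symD; apply: linear_ext => // [|g].
  exact: linear_comp lD (lin_ext_linear _).
apply/malgP => -[s t]; rewrite -symD; move: (D _).
apply: (linear_ext (W := rat^o)) => [c z z'|c z z'|[a b]].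
- by rewrite lin_ext_linear mcoeffD mcoeffZ.
- by rewrite mcoeffD mcoeffZ.
by rewrite lin_extU !mcoeffU !xpair_eqE andbC.
Qed.

Lemma nverts_union s t : nverts (union s t) = (nverts s + nverts t)%N.
Proof. by rewrite nverts_iclass card_sum !card_ord. Qed.

Lemma nverts_eq0 s : (nverts s == 0%N) = (s == eG).
Proof.
apply/eqP/eqP => [s0|->]; last by rewrite nverts_iclass card_void.
by rewrite -(rep_iclass s); apply: void_iso; rewrite card_ord.
Qed.

Section Delta.
Variable P : rule.

Lemma delta_neq0 g p : (delta P << g >>)@_p != 0 ->
  exists Y Z, [/\ splits P (full (rep g)) Y Z, p.1 = cl Y & p.2 = cl Z].
Proof.
case: p => s t; rewrite delta_coeff => n0.
have /card_gt0P[[Y Z]] : (0 < splits_number P s t g)%N.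
  by rewrite lt0n; apply: contraNneq n0 => ->.
by rewrite inE /= => /andP[PYZ /eqP[<- <-]]; exists Y, Z.
Qed.

Lemma delta_nverts g p : (delta P << g >>)@_p != 0 ->
  [/\ (nverts p.1 <= nverts g)%N, (nverts p.2 <= nverts g)%N
    & (nverts g <= nverts p.1 + nverts p.2)%N].
Proof.
move=> /delta_neq0[Y [Z [PYZ -> ->]]]; rewrite !nverts_cl.
have le (X : {set cell 'I_(nverts g)}) : (#|[pred x | inl x \in X]| <= nverts g)%N.
  by rewrite -[X in (_ <= X)%N]card_ord max_card.
split; [exact: le|exact: le|].
rewrite -[X in (X <= _)%N]card_ord -cardUI; apply: leq_trans (leq_addr _ _).
apply: subset_leq_card; apply/subsetP => x _; rewrite !inE.
by apply: splits_cover PYZ _; rewrite ?wf_full ?full_v.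
Qed.

Lemma delta_locally_finite : locally_finite (delta P).
Proof. by move=> g p /delta_nverts[]. Qed.

Lemma delta_coeffC g s t : (delta P << g >>)@_(s, t) = (delta P << g >>)@_(t, s).
Proof.
rewrite !delta_coeff; congr _%:R; rewrite /splits_number.
pose sw (p : {set cell 'I_(nverts g)} * {set cell 'I_(nverts g)}) := (p.2, p.1).
have swK : involutive sw by case.
rewrite -(card_image (inv_inj swK)); apply: eq_card => p; apply/imageP/idP.
  by move=> [q]; rewrite !inE /= => /andP[Pq /eqP[<- <-]] ->; rewrite /= splitsC Pq eqxx.
rewrite inE => /andP[Pp /eqP[<- <-]]; exists (sw p); last by rewrite swK.
by rewrite inE /= splitsC Pp eqxx.
Qed.

End Delta.

Lemma hom_nverts g p : (delta hom_rule << g >>)@_p != 0 ->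
  (nverts p.1 + nverts p.2)%N = nverts g.
Proof.
move=> /delta_neq0[Y [Z [/andP[/and3P[_ _ /eqP X] /eqP YZ] -> ->]]].
rewrite !nverts_cl -cardUI [X in (_ + X)%N]eq_card0 ?addn0 => [|x].
  rewrite -[RHS]card_ord; apply: eq_card => x; rewrite !inE.
  by have := full_v (rep g) x; rewrite X inE => ->.
have /setP/(_ (inl x)) := YZ; rewrite !inE => YZx.
by rewrite YZx.
Qed.

Lemma delta_hom_primitive : primitive_morphism (delta hom_rule).
Proof.
split; [exact: delta_linear|exact: delta_unit|exact: delta_mul|move=> t ct].
rewrite !tensU deltaU; set e := rep t in ct *; set X := full e.
have wX : wf X := wf_full e.
have X0 : X != finset.set0.
  have /andP[/card_gt0P[x _] _] := ct; apply/eqP => /setP/(_ (inl x)).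
  by rewrite full_v inE.
rewrite /split_sum (bigD1 (X, finset.set0)) /=; last first.
  by rewrite -[splits_hom _ _ _]/(splits hom_rule _ _ _) splitsC splits0.
rewrite (bigD1 (finset.set0, X)) /=; last first.
  rewrite -[splits_hom _ _ _]/(splits hom_rule _ _ _) splits0 // eqxx /=.
  by rewrite xpair_eqE eq_sym (negbTE X0).
rewrite cl0 cl_full rep_iclass big1 ?addr0 // => -[Y Z] /= /andP[/andP[PYZ n1] n2].
exfalso.
(* The vertices of a piece form a union of components, hence none or all of a connected graph; this
   leaves only the two decompositions already removed. *)
pose A : {set 'I_(nverts t)} := finset (fun x => inl x \in Y).
have PYZ' := PYZ; move: PYZ' => /andP[/and3P[/wfP wY /wfP wZ /eqP XYZ] /eqP YZ0].
have cA : closed_set e A.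
  apply/closed_setP => x y; rewrite -full_e -/X XYZ !inE => /orP[xy|xy].
    by have [_ -> /wY[_ -> _]] := wY _ _ xy.
  have nY v : inl v \in Z -> inl v \notin Y.
    by move=> vZ; have /setP/(_ (inl v)) := YZ0; rewrite !inE vZ andbT => ->.
  by have [_ /nY/negbTE-> /wZ[_ /nY/negbTE-> _]] := wZ _ _ xy.
have wfY : wf Y by apply/wfP.
have wfZ : wf Z by apply/wfP.
have /orP[/eqP A0|/eqP AT] := connected_closed ct cA.
  move: n2; have Y0 : Y == finset.set0.
    rewrite -cl_eG // -nverts_eq0 nverts_cl; apply/eqP/eq_card0 => x.
    by have /setP/(_ x) := A0; rewrite !inE.
  move: PYZ; rewrite (eqP Y0) -[splits_hom _ _ _]/(splits hom_rule _ _ _) splits0 //.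
  by move=> /eqP->; rewrite eqxx.
move: n1; have Z0 : Z == finset.set0.
  rewrite -cl_eG // -nverts_eq0 nverts_cl; apply/eqP/eq_card0 => x.
  have /setP/(_ x) := AT; have /setP/(_ (inl x)) := YZ0; rewrite !inE => + xY.
  by rewrite xY.
move: PYZ; rewrite (eqP Z0) -[splits_hom _ _ _]/(splits hom_rule _ _ _) splitsC splits0 //.
by move=> /eqP->; rewrite eqxx.
Qed.

(** [Delta_hom'] is known only by its characterisation, so uniqueness of the primitive morphism
    identifies it. *)
Lemma Delta_hom'E : Delta_hom' = delta hom_rule.
Proof. exact: primitive_morphism_unique Delta_hom'P delta_hom_primitive. Qed.

(** * Rescaling by automorphism group orders *)

Definition rescale (c : isoclass -> rat) : QG -> QG := lin_ext (fun t => c t *: << t >>).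

Lemma rescale_linear c : linear (rescale c). Proof. exact: lin_ext_linear. Qed.

Lemma rescaleU c t : rescale c << t >> = c t *: << t >>. Proof. exact: lin_extU. Qed.

Lemma rescale_coeff c x t : (rescale c x)@_t = c t * x@_t.
Proof.
move: x; apply: (linear_ext (W := rat^o)) => [a z z'|a z z'|k].
- by rewrite rescale_linear mcoeffD mcoeffZ.
- by rewrite mcoeffD mcoeffZ mulrDr mulrCA.
by rewrite rescaleU mcoeffZ mcoeffU; case: eqP => [->|]; rewrite ?mulr0.
Qed.

Lemma tens_rescale_coeff c x p :
  (tens_map (rescale c) (rescale c) x)@_p = c p.1 * c p.2 * x@_p.
Proof.
move: x; apply: (linear_ext (W := rat^o)) => [a z z'|a z z'|[k l]].
- by rewrite tens_map_linear mcoeffD mcoeffZ.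
- by rewrite mcoeffD mcoeffZ mulrDr mulrCA.
by rewrite tens_mapU tens_coeff !rescale_coeff -tensU tens_coeff mulrACA.
Qed.

Definition phi := rescale (fun t => (Aut_card t)%:R).
Definition psi := rescale (fun t => (Aut_card t)%:R^-1).

Lemma Aut_neq0 t : (Aut_card t)%:R != 0 :> rat.
Proof. by rewrite Num.Theory.pnatr_eq0 -lt0n Aut_card_gt0. Qed.

Lemma psiK : cancel psi phi.
Proof. by move=> x; apply/malgP => t; rewrite !rescale_coeff mulVKf ?Aut_neq0. Qed.

Lemma phiK : cancel phi psi.
Proof. by move=> x; apply/malgP => t; rewrite !rescale_coeff mulKf ?Aut_neq0. Qed.

(** Ensures that [phi] fixes the unit and the one-vertex graph. *)
Lemma Aut_card1 t : (nverts t <= 1)%N -> Aut_card t = 1%N.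
Proof.
move=> t1; apply/eqP; rewrite eqn_leq Aut_card_gt0 andbT; apply/card_le1_eqP => f h _ _.
have all1 (x y : 'I_(nverts t)) : x = y.
  apply/val_inj; case: x y => x xt [y yt] /=; move: (leq_trans xt t1) (leq_trans yt t1).
  by case: x {xt} => //; case: y {yt}.
by apply/ffunP => x; apply: all1.
Qed.

Lemma phiU t : (nverts t <= 1)%N -> phi << t >> = << t >>.
Proof. by move=> t1; rewrite /phi rescaleU Aut_card1 // scale1r. Qed.

(** * The bialgebras *)

Lemma union_eG s t : (union s t == eG) = (s == eG) && (t == eG).
Proof. by rewrite -!nverts_eq0 nverts_union addn_eq0. Qed.

Lemma unionA : associative union.
Proof.
suff H (U V W : finType) (e : simple_graph U) (f : simple_graph V) (k : simple_graph W) :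
    union (iclass e) (union (iclass f) (iclass k)) = union (union (iclass e) (iclass f)) (iclass k).
  by move=> s t u; have := H _ _ _ (rep s) (rep t) (rep u); rewrite !rep_iclass.
rewrite !union_iclass; apply/iclassP/isoP.
exists (fun x : U + (V + W) => match x with
  inl x => inl (inl x) | inr (inl y) => inl (inr y) | inr (inr z) => inr z end).
  exists (fun x : (U + V) + W => match x with
    inl (inl x) => inl x | inl (inr y) => inr (inl y) | inr z => inr (inr z) end).
    by move=> [x|[y|z]].
  by move=> [[x|y]|z].
by move=> [x|[y|z]] [x'|[y'|z']].
Qed.

Lemma unionC : commutative union.
Proof.
move=> s t; apply/iclassP/isoP.
exists (fun x => match x with inl x => inr x | inr y => inl y end); last by move=> [x|x] [y|y].
by exists (fun x => match x with inl x => inr x | inr y => inl y end) => -[].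
Qed.

Lemma union_eGl : left_id eG union.
Proof.
move=> s; rewrite -[in LHS](rep_iclass s) union_iclass -[RHS]rep_iclass.
apply/iclassP/iso_sym/isoP; exists (fun x => inr x); last by [].
by exists (fun x : void + 'I_(nverts s) => match x with inl x => match x with end | inr y => y end)
  => [|[[]|]].
Qed.

Section Twisted.
Variable P : rule.

(** Conjugation by [phi] trades the denominator [Aut_card s * Aut_card t] of the coefficient at
    [(s, t)] for [Aut_card g]. *)
Definition twisted_delta x := tens_map phi phi (delta P (psi x)).

Lemma twisted_delta_linear : linear twisted_delta.
Proof.
exact: linear_comp (rescale_linear _) (linear_comp (@delta_linear P) (tens_map_linear _ _)).
Qed.

Lemma twisted_delta_coeff g s t :
  (twisted_delta << g >>)@_(s, t) = (splits_count P s t g)%:R / (Aut_card g)%:R.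
Proof.
rewrite /twisted_delta /psi rescaleU (linear_scale (@delta_linear P)).
rewrite (linear_scale (tens_map_linear _ _)) mcoeffZ tens_rescale_coeff delta_coeff.
by rewrite splits_countE !natrM mulrC [X in _ = X * _]mulrC.
Qed.

Lemma delta_count g s t : (delta P << g >>)@_(s, t) =
  (splits_count P s t g)%:R / ((Aut_card s)%:R * (Aut_card t)%:R).
Proof.
by rewrite delta_coeff splits_countE !natrM mulfK // mulf_neq0 ?Aut_neq0.
Qed.

Lemma twisted_delta_neq0 g p : (twisted_delta << g >>)@_p != 0 -> (delta P << g >>)@_p != 0.
Proof.
case: p => s t; rewrite twisted_delta_coeff delta_count !mulf_eq0 !negb_or => /andP[-> _] /=.
by rewrite invr_eq0 mulf_neq0 ?Aut_neq0.
Qed.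

Lemma twisted_delta_locally_finite : locally_finite twisted_delta.
Proof. by move=> g p /twisted_delta_neq0/delta_locally_finite. Qed.

Lemma twisted_delta_coeffC g s t :
  (twisted_delta << g >>)@_(s, t) = (twisted_delta << g >>)@_(t, s).
Proof.
have := delta_coeffC P g s t; rewrite !delta_count [(Aut_card t)%:R * _]mulrC.
rewrite !twisted_delta_coeff => /mulIf-> //.
by rewrite invr_eq0 mulf_neq0 ?Aut_neq0.
Qed.

End Twisted.

(** By [hom_count] the numerator is [Aut_card g] when [g] is the disjoint union and 0 otherwise, so
    the quotient is the 0-1 coefficient of [Delta_hom]. *)
Lemma Delta_homE : Delta_hom = twisted_delta hom_rule.
Proof.
apply: (coproduct_coeff (c := fun t p => pairing << t >> (mul_hom << p.1 >> << p.2 >>))).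
  exact: twisted_delta_linear.
move=> g [s t] /=; rewrite twisted_delta_coeff hom_count mul_homU pairingU mcoeffU eq_sym.
by case: eqP => _; rewrite ?mul0r // divff ?Aut_neq0.
Qed.

Lemma Delta_monoE : Delta_mono = twisted_delta mono_rule.
Proof.
apply: (coproduct_coeff (c := fun t p => (Mcount p.1 p.2 t)%:R / (Aut_card t)%:R)).
  exact: twisted_delta_linear.
by move=> g [s t]; rewrite twisted_delta_coeff Mcount_splits.
Qed.

Lemma Delta_mono'E : Delta_mono' = delta mono_rule.
Proof.
apply: (coproduct_coeff (c := fun t p =>
  (Mcount p.1 p.2 t)%:R / ((Aut_card p.1)%:R * (Aut_card p.2)%:R))).
  exact: delta_linear.
by move=> g [s t]; rewrite delta_count Mcount_splits.
Qed.

Lemma Delta_regmonoE : Delta_regmono = twisted_delta regmono_rule.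
Proof.
apply: (coproduct_coeff (c := fun t p => (Rcount p.1 p.2 t)%:R / (Aut_card t)%:R)).
  exact: twisted_delta_linear.
by move=> g [s t]; rewrite twisted_delta_coeff Rcount_splits.
Qed.

Lemma Delta_regmono'E : Delta_regmono' = delta regmono_rule.
Proof.
apply: (coproduct_coeff (c := fun t p =>
  (Rcount p.1 p.2 t)%:R / ((Aut_card p.1)%:R * (Aut_card p.2)%:R))).
  exact: delta_linear.
by move=> g [s t]; rewrite delta_count Rcount_splits.
Qed.

(** Exhibits disjoint union itself as a dual product, so that it falls under the general results for
    [hom_rule]. *)
Lemma mul_homE : mul_hom = dual_mul (twisted_delta hom_rule).
Proof.
apply/funext => x; apply/funext => y; move: x y.
apply: bilin_basis_ext => [y|x|y|x|s t].
- exact: mul_hom_linearl.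
- exact: mul_hom_linearr.
- exact: dual_mul_linearl.
- exact: dual_mul_linearr.
apply/malgP => g; rewrite dual_mul_coeff; last exact: twisted_delta_locally_finite.
rewrite twisted_delta_coeff hom_count mul_homU mcoeffU eq_sym.
by case: eqP => _; rewrite ?mul0r // divff ?Aut_neq0.
Qed.

Lemma mul_homA : associative mul_hom.
Proof.
move=> x y z; move: y z; apply: bilin_basis_ext => [z|y|z|y|t u].
- exact: linear_comp (mul_hom_linearl _) (mul_hom_linearr _).
- exact: linear_comp (mul_hom_linearr _) (mul_hom_linearr _).
- exact: linear_comp (mul_hom_linearr _) (mul_hom_linearl _).
- exact: mul_hom_linearr.
move: x; apply: linear_ext => [||s].
- exact: mul_hom_linearl.
- exact: linear_comp (mul_hom_linearl _) (mul_hom_linearl _).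
by rewrite !mul_homU unionA.
Qed.

Lemma adjoint_mul_hom : adjoint (product_map mul_hom) Delta_hom.
Proof. by rewrite mul_homE Delta_homE; apply/product_dual_mul/twisted_delta_locally_finite. Qed.

Section Bialgebras.
Variable P : rule.

Lemma bialgebra_hom_delta : bialgebra mul_hom unit_map (delta P) counit.
Proof.
have uE : unit_map 1 = << eG >> by rewrite /unit_map scale1r.
split.
- exact: mul_hom_linearl.
- exact: mul_hom_linearr.
- by move=> a x y; rewrite /unit_map scalerDl scalerA.
- exact: delta_linear.
- by move=> a x y; rewrite /counit mcoeffD mcoeffZ.
- exact: mul_homA.
- move=> x; rewrite uE; move: x; apply: linear_ext => // [|t]; first exact: mul_hom_linearr.
  by rewrite mul_homU union_eGl.
- move=> x; rewrite uE; move: x; apply: linear_ext => // [|t]; first exact: mul_hom_linearl.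
  by rewrite mul_homU unionC union_eGl.
- exact: delta_coassoc.
- exact: delta_counit.
- move=> x; rewrite -[in LHS](delta_cocomm P x) -[RHS](delta_counit P x).
  move: (delta P x); apply: linear_ext => [||[a b]].
  + exact: linear_comp (lin_ext_linear _) (lin_ext_linear _).
  + exact: lin_ext_linear.
  by rewrite !lin_extU.
- exact: delta_mul.
- by rewrite uE delta_unit.
- apply: (bilin_basis_ext (W := rat^o) (f := fun x y => counit (mul_hom x y))
    (g := fun x y => counit x * counit y)) => [y|x|y|x|s t] => [c z z'|c z z'|c z z'|c z z'|].
  + by rewrite mul_hom_linearl /counit mcoeffD mcoeffZ.
  + by rewrite mul_hom_linearr /counit mcoeffD mcoeffZ.
  + by rewrite /counit mcoeffD mcoeffZ mulrDl -mulrA.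
  + by rewrite /counit mcoeffD mcoeffZ mulrDr mulrCA.
  rewrite mul_homU /counit !mcoeffU union_eG.
  by case: (s == eG); case: (t == eG).
by rewrite uE /counit mcoeffUU.
Qed.

Lemma bialgebra_dual_hom : bialgebra (dual_mul (delta P)) unit_map Delta_hom counit.
Proof.
apply: (dual_bialgebra bialgebra_hom_delta) adjoint_mul_hom (product_dual_mul _).
- exact: dual_mul_linearl.
- exact: dual_mul_linearr.
- by rewrite Delta_homE; apply: twisted_delta_linear.
exact: delta_locally_finite.
Qed.

Lemma phi_eG : phi << eG >> = << eG >>.
Proof. by apply: phiU; rewrite nverts_iclass card_void. Qed.

Lemma phi_counit x : (phi x)@_eG = x@_eG.
Proof. by rewrite rescale_coeff Aut_card1 ?mul1r // nverts_iclass card_void. Qed.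

(** Both sides have coefficient [Aut_card g] at [g = union s t]: there the structure constant of
    [mul_hom'] is |Aut g| / (|Aut s| |Aut t|). *)
Lemma phi_mul x y : phi (mul_hom x y) = mul_hom' (phi x) (phi y).
Proof.
have lphi := rescale_linear (fun t => (Aut_card t)%:R) : linear phi.
move: x y; apply: bilin_basis_ext => [y|x|y|x|s t].
- exact: linear_comp (mul_hom_linearl _) lphi.
- exact: linear_comp (mul_hom_linearr _) lphi.
- exact: linear_comp lphi (dual_mul_linearl _ _).
- exact: linear_comp lphi (dual_mul_linearr _ _).
apply/malgP => g; rewrite /phi rescale_coeff mul_homU mcoeffU !rescaleU.
rewrite /mul_hom' (linear_scale (dual_mul_linearl _ _)).
rewrite (linear_scale (dual_mul_linearr _ _)) !mcoeffZ.
rewrite Delta_hom'E dual_mul_coeff; last exact: delta_locally_finite.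
rewrite delta_count hom_count eq_sym mulrA mulrCA divff ?mulr1 ?mulf_neq0 ?Aut_neq0 //.
by case: eqP => [->|]; rewrite ?mulr1 ?mulr0.
Qed.

Lemma phi_delta x : twisted_delta P (phi x) = tens_map phi phi (delta P x).
Proof. by rewrite /twisted_delta phiK. Qed.

Lemma bialgebra_hom'_twisted : bialgebra mul_hom' unit_map (twisted_delta P) counit.
Proof.
apply: (transport_bialgebra (rescale_linear _) psiK phi_eG phi_counit phi_mul phi_delta).
- exact: dual_mul_linearl.
- exact: dual_mul_linearr.
- exact: twisted_delta_linear.
exact: bialgebra_hom_delta.
Qed.

Lemma bialgebra_dual_hom' :
  bialgebra (dual_mul (twisted_delta P)) unit_map Delta_hom' counit.
Proof.
apply: (dual_bialgebra bialgebra_hom'_twisted).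
- exact: dual_mul_linearl.
- exact: dual_mul_linearr.
- by rewrite Delta_hom'E; apply: delta_linear.
- rewrite /mul_hom' Delta_hom'E; apply/product_dual_mul/delta_locally_finite.
exact/product_dual_mul/twisted_delta_locally_finite.
Qed.

Lemma nverts_eG s : nverts s = 0%N -> s = eG.
Proof. by move=> s0; apply/eqP; rewrite -nverts_eq0 s0. Qed.

Lemma hopf_dual_hom : hopf_algebra (dual_mul (delta P)) unit_map Delta_hom counit.
Proof.
split; first exact: bialgebra_dual_hom.
apply: (antipode_exists nverts_eG _ bialgebra_dual_hom).
- by move=> k p; rewrite Delta_homE => /twisted_delta_neq0/hom_nverts.
- exact: dual_mulC (@delta_locally_finite P) (@delta_coeffC P).
rewrite Delta_homE; apply: cocomm_coeff; [exact: twisted_delta_linear|].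
exact: twisted_delta_coeffC.
Qed.

Lemma hopf_dual_hom' : hopf_algebra (dual_mul (twisted_delta P)) unit_map Delta_hom' counit.
Proof.
split; first exact: bialgebra_dual_hom'.
apply: (antipode_exists nverts_eG _ bialgebra_dual_hom').
- by move=> k p; rewrite Delta_hom'E => /hom_nverts.
- exact: dual_mulC (@twisted_delta_locally_finite P) (@twisted_delta_coeffC P).
rewrite Delta_hom'E; apply: cocomm_coeff; [exact: delta_linear|exact: delta_coeffC].
Qed.

End Bialgebras.

(** * Filtrations and the failure of the antipode *)

Section Respects.
Variable Q : nat -> nat -> Prop.
Let A (n : nat) (x : QG) : Prop := forall s, s \in msupp x -> Q n (nverts s).

(** Serves both the grading, with [Q n m] being [m = n], and the filtration, with [m <= n]. The
    coproduct is cut according to the exact number of vertices of the first factor, which puts the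
    second in level [n] minus that number. *)
Lemma respects_coeff mul D :
  (forall y, linear (mul^~ y)) -> (forall x, linear (mul x)) -> linear D ->
  (forall n m s t g, Q n (nverts s) -> Q m (nverts t) ->
     (mul << s >> << t >>)@_g != 0 -> Q (n + m)%N (nverts g)) ->
  (forall n g p, Q n (nverts g) -> (D << g >>)@_p != 0 ->
     [/\ (nverts p.1 <= n)%N, Q (nverts p.1) (nverts p.1) & Q (n - nverts p.1)%N (nverts p.2)]) ->
  respects mul D A.
Proof.
move=> ml mr lD Qmul QD; split=> [n m x y xn ym g|n x xn].
  rewrite -mcoeff_neq0 (linear_sumE x (ml y)) raddf_sum /= => n0.
  apply: contrapT => Qg; move: n0; rewrite big1_seq ?eqxx // => s /andP[_ sx].
  rewrite (linear_sumE y (mr _)) mcoeffZ raddf_sum /=.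
  rewrite big1_seq ?mulr0 // => t /andP[_ ty]; rewrite mcoeffZ.
  have [->|n0] := eqVneq (mul << s >> << t >>)@_g 0; first by rewrite mulr0.
  by case: Qg; apply: Qmul n0; [apply: xn|apply: ym].
have supp p : p \in msupp (D x) ->
    [/\ (nverts p.1 <= n)%N, Q (nverts p.1) (nverts p.1) & Q (n - nverts p.1)%N (nverts p.2)].
  rewrite -mcoeff_neq0 (linear_sumE x lD) raddf_sum /= => n0.
  suff [s sx /QD] : exists2 s, s \in msupp x & (D << s >>)@_p != 0 by apply; apply: xn.
  apply: contrapT => none; move: n0; rewrite big1_seq ?eqxx // => s /andP[_ sx].
  rewrite mcoeffZ; have [->|n0] := eqVneq (D << s >>)@_p 0; first by rewrite mulr0.
  by case: none; exists s.
pose r i : seq (isoclass * isoclass) := [seq p <- msupp (D x) | nverts p.1 == i].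
exists (fun i : 'I_n.+1 => \sum_(p <- r i) (D x)@_p *: << p >>).
  move=> i; exists [seq ((D x)@_p *: << p.1 >> : QG, << p.2 >> : QG) | p <- r i].
    move=> _ /mapP[p + ->] /=; rewrite mem_filter => /andP[/eqP pi /supp[_ Q1 Q2]].
    by rewrite -pi; split=> s /=; [move=> /(fsubsetP (msuppZ_le _ _))|];
      rewrite msuppU oner_eq0 in_fset1 => /eqP->.
  rewrite big_map; apply: eq_bigr => -[s t] _ /=.
  by rewrite (linear_scale (tens_linearl _)) tensU.
rewrite [LHS](linear_sumE _ (@id_linear _)).
under [RHS]eq_bigr do rewrite big_filter.
rewrite (exchange_big_dep xpredT) //= big_seq_cond [RHS]big_seq_cond.
apply: eq_bigr => p /andP[/supp[pn _ _] _].
(* Each term of [D x] falls in exactly one slice; [inord] is faithful because [nverts p.1 <= n] on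
   the support. *)
rewrite (big_pred1 (inord (nverts p.1))) // => i.
by rewrite /= -(inj_eq val_inj) /= inordK // eq_sym.
Qed.

End Respects.

Lemma connected_coeff (Q : nat -> nat -> Prop) : (forall n, Q 0%N n <-> n = 0%N) ->
  connected unit_map (fun n (x : QG) => forall s, s \in msupp x -> Q n (nverts s)).
Proof.
move=> Q0 x; split=> [x0|[c ->] s].
  exists x@_eG; apply/malgP => s; rewrite mcoeffZ mcoeffU.
  have [<-|ns] := eqVneq eG s; first by rewrite mulr1.
  rewrite mulr0; apply: mcoeff_outdom; apply: contra ns => /x0.
  by move=> /Q0/eqP; rewrite nverts_eq0 eq_sym.
move=> /(fsubsetP (msuppZ_le _ _)); rewrite msuppU oner_eq0 in_fset1 => /eqP->.
by apply/Q0/eqP; rewrite nverts_eq0.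
Qed.

Lemma filtered_hopf mul D : (forall y, linear (mul^~ y)) -> (forall x, linear (mul x)) ->
  linear D ->
  (forall s t g, (mul << s >> << t >>)@_g != 0 -> (nverts g <= nverts s + nverts t)%N) ->
  (forall g p, (D << g >>)@_p != 0 -> (nverts p.1 + nverts p.2)%N = nverts g) ->
  hopf_algebra mul unit_map D counit -> connected_filtered_hopf mul D.
Proof.
move=> ml mr lD mQ DQ H; split=> //; last first.
  by apply: (@connected_coeff (fun n m => m <= n)%N) => n; rewrite leqn0; split=> /eqP.
apply: (@respects_coeff (fun n m => m <= n)%N) => // [n m s t g sn tm /mQ le|n g p gn /DQ gE].
  by apply: leq_trans le _; apply: leq_add.
rewrite leqnn -gE in gn *; split=> //; first by apply: leq_trans gn; apply: leq_addr.
by rewrite leq_subRL ?(leq_trans _ gn) ?leq_addr.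
Qed.

Lemma graded_hopf mul D : (forall y, linear (mul^~ y)) -> (forall x, linear (mul x)) ->
  linear D ->
  (forall s t g, (mul << s >> << t >>)@_g != 0 -> nverts g = (nverts s + nverts t)%N) ->
  (forall g p, (D << g >>)@_p != 0 -> (nverts p.1 + nverts p.2)%N = nverts g) ->
  hopf_algebra mul unit_map D counit -> connected_graded_hopf mul D.
Proof.
move=> ml mr lD mQ DQ H; split=> //; last by apply: (@connected_coeff (fun n m => m = n)).
apply: (@respects_coeff (fun n m => m = n)) => // [n m s t g <- <- /mQ//|n g p <- /DQ<-].
by rewrite leq_addr addKn.
Qed.

Section Structures.
Variable P : rule.

Lemma hom_filtered : connected_filtered_hopf (dual_mul (delta P)) Delta_hom.
Proof.
apply: filtered_hopf.
- exact: dual_mul_linearl.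
- exact: dual_mul_linearr.
- by rewrite Delta_homE; apply: twisted_delta_linear.
- move=> s t g; rewrite dual_mul_coeff; last exact: delta_locally_finite.
  exact: delta_locally_finite.
- by move=> g p; rewrite Delta_homE => /twisted_delta_neq0/hom_nverts.
exact: hopf_dual_hom.
Qed.

Lemma hom'_filtered : connected_filtered_hopf (dual_mul (twisted_delta P)) Delta_hom'.
Proof.
apply: filtered_hopf.
- exact: dual_mul_linearl.
- exact: dual_mul_linearr.
- by rewrite Delta_hom'E; apply: delta_linear.
- move=> s t g; rewrite dual_mul_coeff; last exact: twisted_delta_locally_finite.
  exact: twisted_delta_locally_finite.
- by move=> g p; rewrite Delta_hom'E => /hom_nverts.
exact: hopf_dual_hom'.
Qed.

End Structures.

(** * The one-vertex graph as an obstruction to the antipode *)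

Definition point : simple_graph unit :=
  @SimpleGraph unit (fun _ _ => false) (fun _ _ => erefl) (fun _ => erefl).

Local Notation pt := (iclass point).

Lemma nverts_pt : nverts pt = 1%N. Proof. by rewrite nverts_iclass card_unit. Qed.

Lemma pt_neq : pt != eG. Proof. by rewrite -nverts_eq0 nverts_pt. Qed.

Definition sign : QG -> rat := lin_ext (fun t => (-1) ^+ nverts t : rat^o).

Lemma signU t : sign << t >> = (-1) ^+ nverts t. Proof. exact: (lin_extU (W := rat^o)). Qed.

Lemma sign_scalar : scalar sign.
Proof. exact: (lin_ext_linear (W := rat^o)). Qed.

Lemma signM x y : sign (mul_hom x y) = sign x * sign y.
Proof.
move: x y; apply: (bilin_basis_ext (W := rat^o) (f := fun x y => sign (mul_hom x y))
    (g := fun x y => sign x * sign y)) => [y|x|y|x|s t] => [c z z'|c z z'|c z z'|c z z'|].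
- by rewrite mul_hom_linearl sign_scalar.
- by rewrite mul_hom_linearr sign_scalar.
- by rewrite sign_scalar mulrDl -mulrA.
- by rewrite sign_scalar mulrDr mulrCA.
by rewrite mul_homU !signU nverts_union exprD.
Qed.

Section NoAntipode.
Variable P : rule.
Hypothesis splits_pt : splits P (full point) (full point) (full point).

(** The hypothesis [splits_pt] lets both pieces be the whole point and yields the third term, which
    the disjointness in [hom_rule] excludes. *)
Lemma delta_pt : delta P << pt >> = << (pt, eG) >> + << (eG, pt) >> + << (pt, pt) >>.
Proof.
rewrite delta_iclass /split_sum; set X := full point; have wX : wf X := wf_full _.
have X0 : X != finset.set0 by apply/eqP => /setP/(_ (inl tt)); rewrite full_v inE.
(* The point has two subgraphs, hence four pairs; the three nonzero terms are extracted and the pair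
   of empty sets does not cover. *)
have XE Y : wf Y -> Y \subset X -> Y = finset.set0 \/ Y = X.
  move=> wY YX; have X1 : X = [set inl tt]%SET.
    by apply/setP => -[[]|[[] []]]; rewrite !inE.
  by move: YX; rewrite X1 subset1 => /orP[/eqP|/eqP]; [right|left].
rewrite (bigD1 (X, finset.set0)) /=; last by rewrite splitsC splits0.
rewrite (bigD1 (finset.set0, X)) /=; last first.
  by rewrite splits0 // eqxx xpair_eqE eq_sym (negbTE X0).
rewrite (bigD1 (X, X)) /=; last first.
  by rewrite splits_pt !xpair_eqE eqxx X0 (negbTE X0).
rewrite big1 => [|[Y Z] /= /andP[/andP[/andP[PYZ n1] n2] n3]].
  by rewrite addr0 cl0 cl_full addrA.
have [wY wZ sY sZ] := splits_sub wX PYZ; exfalso.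
have [YE|YE] := XE _ wY sY; have [ZE|ZE] := XE _ wZ sZ; move: PYZ n1 n2 n3;
  rewrite YE ZE ?eqxx ?andbF //.
by rewrite splits0 // eq_sym (negbTE X0).
Qed.

Lemma hom_no_antipode : bialgebra_without_antipode mul_hom (delta P).
Proof.
split; first exact: bialgebra_hom_delta.
apply: (no_antipode (bialgebra_hom_delta P) pt_neq sign_scalar signM _ delta_pt).
by rewrite signU nverts_pt expr1.
Qed.

Lemma hom'_no_antipode : bialgebra_without_antipode mul_hom' (twisted_delta P).
Proof.
split; first exact: bialgebra_hom'_twisted.
have phi_pt : phi << pt >> = << pt >> by apply: phiU; rewrite nverts_pt.
have psi_pt : psi << pt >> = << pt >> by rewrite -[in LHS]phi_pt phiK.
(* [sign] is a character for [mul_hom]; precomposed with [psi] it is one for [mul_hom'], with the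
   same value at the point. *)
apply: (@no_antipode _ _ pt _ _ (fun x => sign (psi x)) (bialgebra_hom'_twisted P)).
- exact: pt_neq.
- have lpsi : linear psi by apply: rescale_linear.
  by move=> c x y; rewrite lpsi sign_scalar.
- by move=> x y; rewrite -signM -{1}(psiK x) -{1}(psiK y) -phi_mul phiK.
- by rewrite psi_pt signU nverts_pt expr1.
rewrite -[in LHS]phi_pt phi_delta delta_pt !(linear_add (tens_map_linear _ _)).
by rewrite !tens_mapU phi_pt phi_eG !tensU.
Qed.

End NoAntipode.

Lemma mono_pt : splits mono_rule (full point) (full point) (full point).
Proof. by rewrite /= /splits_mono wf_full finset.setUid eqxx. Qed.

Lemma regmono_pt : splits regmono_rule (full point) (full point) (full point).
Proof.
rewrite /= /splits_regmono; have -> : full point == ind (full point) (full point).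
  by apply/eqP/setP => -[x|[x y]]; rewrite !inE.
by apply/forallP => x; rewrite full_v.
Qed.

Theorem proposition1p29 :
  (* (1) *)
  (connected_graded_hopf mul_hom Delta_hom' /\
   connected_graded_hopf mul_hom' Delta_hom) /\
  (* (2) *)
  (connected_filtered_hopf mul_mono Delta_hom' /\
   connected_filtered_hopf mul_mono' Delta_hom /\
   connected_filtered_hopf mul_regmono Delta_hom' /\
   connected_filtered_hopf mul_regmono' Delta_hom) /\
  (* (3) *)
  (bialgebra_without_antipode mul_hom' Delta_mono /\
   bialgebra_without_antipode mul_hom Delta_mono' /\
   bialgebra_without_antipode mul_hom' Delta_regmono /\
   bialgebra_without_antipode mul_hom Delta_regmono').
Proof.
split; [split|split; [split; [|split; [|split]]|split; [|split; [|split]]]].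
- apply: graded_hopf.
  + exact: mul_hom_linearl.
  + exact: mul_hom_linearr.
  + by rewrite Delta_hom'E; apply: delta_linear.
  + move=> s t g; rewrite mul_homU mcoeffU.
    have [<- _|_] := eqVneq (union s t) g; last by rewrite mulr0n eqxx.
    exact: nverts_union.
  + by move=> g p; rewrite Delta_hom'E => /hom_nverts.
  (* Both pairs of the graded case are self-dual instances of the filtered construction, taken at
     [hom_rule]. *)
  by rewrite mul_homE; apply: hopf_dual_hom'.
- apply: graded_hopf.
  + exact: dual_mul_linearl.
  + exact: dual_mul_linearr.
  + by rewrite Delta_homE; apply: twisted_delta_linear.
  + move=> s t g; rewrite /mul_hom' Delta_hom'E dual_mul_coeff; last exact: delta_locally_finite.
    by move=> /hom_nverts.
  + by move=> g p; rewrite Delta_homE => /twisted_delta_neq0/hom_nverts.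
  by rewrite /mul_hom' Delta_hom'E; apply: hopf_dual_hom.
- by rewrite /mul_mono Delta_monoE; apply: hom'_filtered.
- by rewrite /mul_mono' Delta_mono'E; apply: hom_filtered.
- by rewrite /mul_regmono Delta_regmonoE; apply: hom'_filtered.
- by rewrite /mul_regmono' Delta_regmono'E; apply: hom_filtered.
- by rewrite Delta_monoE; apply: hom'_no_antipode mono_pt.
- by rewrite Delta_mono'E; apply: hom_no_antipode mono_pt.
- by rewrite Delta_regmonoE; apply: hom'_no_antipode regmono_pt.
by rewrite Delta_regmono'E; apply: hom_no_antipode regmono_pt.
Qed.
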